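(* Let $N\ge 2$ and let $\mathscr{O}_{1,1}$ be the diagonal overlap associated with the eigenvalue $\lambda_1$ of a matrix distributed according to the spherical ensemble $\mathrm{Sph}(N)$. Conditionally on the spectrum $\Lambda=(\lambda_1,\dots,\lambda_N)$ (with distinct $\lambda_i$), $$\mathscr{O}_{1,1}\ \stackrel{d}{=}\ \prod_{k=2}^N\left(1+\frac{(1+|\lambda_1|^2)(1+|\lambda_k|^2)}{|\lambda_1-\lambda_k|^2}\,X_N^{(k)}\right),$$ where $X_N^{(2)},\dots,X_N^{(N)}$ are i.i.d. real random variables with density $\frac{N+1}{(1+x)^{N+2}}\mathbf{1}_{x>0}$ with respect to Lebesgue measure. In particular, $$\mathbb{E}_\Lambda(\mathscr{O}_{1,1})=\prod_{k=2}^N\left(1+\frac{(1+|\lambda_1|^2)(1+|\lambda_k|^2)}{N|\lambda_1-\lambda_k|^2}\right).$$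
   Context: $\mathrm{Sph}(N)$ is the law of $G=G_1G_2^{-1}$, where $G_1,G_2$ are independent $N\times N$ complex Ginibre matrices (i.i.d. centered complex Gaussian entries). The spectrum is almost surely simple; the eigenvalues $\lambda_1,\dots,\lambda_N$ are labelled exchangeably (uniformly random labelling). Overlaps: for a matrix $G$ with simple spectrum, let $R_j$ be right eigenvectors (columns) and $L_j$ left eigenvectors (rows) with $GR_j=\lambda_jR_j$, $L_jG=\lambda_jL_j$, $L_iR_j=\delta_{ij}$. Then $\mathscr{O}_{i,j}=(L_iL_j^* )(R_j^*R_i)$; this does not depend on the choice of such eigenvectors and is invariant under unitary change of basis. Schur form and conditioning: $G$ can be written $G=UTU^*$ with $U$ unitary (suitably chosen at random) and $T$ upper triangular with diagonal $(\lambda_1,\dots,\lambda_N)$, such that $T$ has density proportional to $\prod_{i<j}|\lambda_i-\lambda_j|^2\det(I_N+TT^* )^{-2N}$ with respect to Lebesgue measure on all diagonal and strictly upper-triangular complex entries. The overlaps of $G$ equal those of $T$. Conditioning on $\Lambda$ means fixing the diagonal of $T$ and renormalizing this density in the strictly upper-triangular entries; $\mathbb{E}_\Lambda$ is the corresponding conditional expectation. *)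

(* Defs.v *)
From HB Require Import structures.
From mathcomp Require Import all_boot all_order all_algebra.
From mathcomp Require Import sesquilinear spectral.
From mathcomp Require Import complex.
From mathcomp Require Import all_classical all_reals all_analysis measurable_realfun.

Set Implicit Arguments.
Unset Strict Implicit.
Unset Printing Implicit Defensive.

Import Order.TTheory GRing.Theory Num.Theory.
Import numFieldNormedType.Exports.

Local Open Scope classical_set_scope.
Local Open Scope ring_scope.
Local Open Scope sesquilinear_scope.

Section product_sigma_finite.
Local Open Scope ereal_scope.
Context d1 d2 (T1 : measurableType d1) (T2 : measurableType d2) (R : realType).
Variables (m1 : {sigma_finite_measure set T1 -> \bar R})
          (m2 : {sigma_finite_measure set T2 -> \bar R}).

Lemma product_sigma_finite : sigma_finite [set: T1 * T2] (m1 \x m2).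
Proof.
have /sigma_finiteP[F1 [U1 nd1 fin1]] := sigma_finiteT m1.
have /sigma_finiteP[F2 [U2 nd2 fin2]] := sigma_finiteT m2.
exists (fun n => F1 n `*` F2 n).
  apply/esym; rewrite -subTset => -[x y] _.
  have : (\bigcup_i F1 i) x by rewrite -U1.
  have : (\bigcup_i F2 i) y by rewrite -U2.
  move=> [j _ Fj] [i _ Fi]; exists (maxn i j) => //; split => /=.
    by have /subsetPset := nd1 _ _ (leq_maxl i j); apply.
  by have /subsetPset := nd2 _ _ (leq_maxr i j); apply.
move=> k; have [mF1 lt1] := fin1 k; have [mF2 lt2] := fin2 k; split.
  exact: measurableX.
by rewrite product_measure1E// lte_mul_pinfty// ge0_fin_numE.
Qed.

End product_sigma_finite.

Section tuple_measure.
Local Open Scope ereal_scope.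
Context d (T : measurableType d) (R : realType).

Definition cons_pair n (p : T * n.-tuple T) : n.+1.-tuple T :=
  [tuple of p.1 :: p.2].

Lemma measurable_cons_pair n : measurable_fun setT (@cons_pair n).
Proof. exact: (measurable_cons measurable_fst measurable_snd). Qed.

Variable mu : {sigma_finite_measure set T -> \bar R}.

Section cons_measure.
Variables (n : nat) (nu : {sigma_finite_measure set (n.-tuple T) -> \bar R}).

Definition cons_measure : set (n.+1.-tuple T) -> \bar R :=
  pushforward (mu \x nu) (@cons_pair n).

Let cons_measure0 : cons_measure set0 = 0.
Proof. by rewrite /cons_measure /pushforward preimage_set0 measure0. Qed.

Let cons_measure_ge0 A : 0 <= cons_measure A.
Proof. by rewrite /cons_measure /pushforward; exact: measure_ge0. Qed.

Let mcons A : measurable A -> measurable (@cons_pair n @^-1` A).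
Proof. by move=> mA; rewrite -[X in measurable X]setTI; exact: (@measurable_cons_pair n). Qed.

Let cons_measure_sigma_additive : semi_sigma_additive cons_measure.
Proof.
move=> F mF tF mUF; rewrite /cons_measure /pushforward preimage_bigcup.
apply: measure_semi_sigma_additive.
- by move=> i; exact: mcons.
- apply/trivIsetP => i j _ _ ij; rewrite -preimage_setI.
  by move/trivIsetP : tF => /(_ _ _ _ _ ij) ->//; rewrite preimage_set0.
- by rewrite -preimage_bigcup; exact: mcons.
Qed.

HB.instance Definition _ := isMeasure.Build _ _ _ cons_measure
  cons_measure0 cons_measure_ge0 cons_measure_sigma_additive.

Let cons_measure_sigma_finite : sigma_finite setT cons_measure.
Proof.
have [F UF finF] := product_sigma_finite mu nu.
pose split_ (t : n.+1.-tuple T) := (thead t, [tuple of behead t]).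
have msplit : measurable_fun setT split_.
  apply/measurable_fun_pair => /=; last exact: measurable_behead.
  exact: measurable_tnth.
have consK : cancel (@cons_pair n) split_.
  by move=> [x t]; rewrite /split_ /cons_pair theadE; congr pair; apply/val_inj.
exists (fun k => split_ @^-1` F k).
  by rewrite -preimage_bigcup -UF preimage_setT.
move=> k; have [mF ltF] := finF k; split.
  by rewrite -[X in measurable X]setTI; exact: msplit.
rewrite /cons_measure /pushforward -comp_preimage.
by rewrite (_ : _ \o _ = id) ?preimage_id//; apply/funext.
Qed.

HB.instance Definition _ :=
  Measure_isSigmaFinite.Build _ _ _ cons_measure cons_measure_sigma_finite.

End cons_measure.

(* The [n]-fold product measure of [mu]. *)
Fixpoint tuple_measure n : {sigma_finite_measure set (n.-tuple T) -> \bar R} :=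
  if n is n'.+1 then cons_measure (tuple_measure n') else \d_ [tuple].

End tuple_measure.

Section overlap.
Context {R : realType} {N : nat}.
Implicit Types (G : 'M[R[i]]_N) (lam : 'I_N -> R[i]).

Definition eigenvectors G lam (Rv : 'I_N -> 'cV[R[i]]_N)
    (Lv : 'I_N -> 'rV[R[i]]_N) : Prop :=
  [/\ forall j, G *m Rv j = lam j *: Rv j,
      forall j, Lv j *m G = lam j *: Lv j
    & forall i j, Lv i *m Rv j = (i == j)%:R%:M].

(* The value is the same for every choice of [Rv] and [Lv] when [lam] is
   injective and lists the spectrum of [G]; the default value 0 is then never
   used. *)
Definition overlap G lam (i j : 'I_N) : R[i] :=
  xget 0 [set o | exists Rv Lv, eigenvectors G lam Rv Lv /\
    (Lv i *m (Lv j)^t*) *m ((Rv j)^t* *m Rv i) = o%:M].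

(* [overlap G lam i i] is the product of the squared norms of [Lv i] and
   [Rv i], hence has no imaginary part. *)
Definition diag_overlap G lam (i : 'I_N) : R := complex.Re (overlap G lam i i).

End overlap.

(* [R[i]] has no measurable structure; a complex variable of integration is
   represented by the pair of its real and imaginary parts. *)
Notation planeT R := (measurableTypeR R * measurableTypeR R)%type.

Section schur.
Context {R : realType}.

Definition lebesgue_C : set (planeT R) -> \bar R :=
  (@lebesgue_measure R \x @lebesgue_measure R)%E.

HB.instance Definition _ := Measure.on lebesgue_C.

Let lebesgue_C_sigma_finite : sigma_finite setT lebesgue_C.
Proof. exact: product_sigma_finite. Qed.

HB.instance Definition _ :=
  Measure_isSigmaFinite.Build _ _ _ lebesgue_C lebesgue_C_sigma_finite.

Context {N : nat}.
Implicit Types (lam : 'I_N -> R[i]) (z : 'C(N, 2).-tuple (planeT R)).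

(* The strictly upper-triangular entries are listed column by column, from top
   to bottom: columns 0, ..., j - 1 contain 'C(j, 2) of them, so the entry in
   row i < j of column j is in position 'C(j, 2) + i. *)
Definition schur_mx lam z : 'M[R[i]]_N :=
  \matrix_(i, j)
    if i == j then lam i
    else if (i < j)%N then
      let w := nth (0 : R, 0 : R) z ('C(j, 2) + i)%N in
      Complex (w.1 : R) (w.2 : R)
    else 0.

(* Unnormalized joint density, in the diagonal [lam] and the strictly
   upper-triangular entries [z], of the Schur form [T] of the spherical
   ensemble. The determinant is that of a positive definite Hermitian matrix,
   hence has no imaginary part. *)
Definition schur_density lam z : R :=
  (\prod_(i < N) \prod_(j < N | (i < j)%N) Normc.normc (lam i - lam j) ^+ 2) *
  complex.Re (\det (1%:M + schur_mx lam z *m (schur_mx lam z)^t*)) ^- (2 * N)%N.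

Definition schur_cond_unnormalized lam (B : set ('C(N, 2).-tuple (planeT R))) :
    \bar R :=
  (\int[tuple_measure lebesgue_C 'C(N, 2)]_(z in B) (schur_density lam z)%:E)%E.

Section measurability.
Context d (T : measurableType d).

Let cmeas (f : T -> R[i]) := measurable_fun setT (@complex.Re R \o f) /\
  measurable_fun setT (@complex.Im R \o f).

Let cmeas_cst c : cmeas (fun=> c).
Proof. by split; exact: measurable_cst. Qed.

Let cmeasD f g : cmeas f -> cmeas g -> cmeas (fun x => f x + g x).
Proof.
move=> [f1 f2] [g1 g2]; split.
  rewrite (_ : _ \o _ = (@complex.Re R \o f) \+ (@complex.Re R \o g)).
    exact: measurable_funD.
  by apply/funext => x /=; case: (f x) (g x) => ? ? [].
rewrite (_ : _ \o _ = (@complex.Im R \o f) \+ (@complex.Im R \o g)).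
  exact: measurable_funD.
by apply/funext => x /=; case: (f x) (g x) => ? ? [].
Qed.

Let cmeasM f g : cmeas f -> cmeas g -> cmeas (fun x => f x * g x).
Proof.
move=> [f1 f2] [g1 g2]; split.
  rewrite (_ : _ \o _ = (@complex.Re R \o f) \* (@complex.Re R \o g) \-
                        (@complex.Im R \o f) \* (@complex.Im R \o g)).
    by apply: measurable_funB; exact: measurable_funM.
  by apply/funext => x /=; case: (f x) (g x) => ? ? [].
rewrite (_ : _ \o _ = (@complex.Re R \o f) \* (@complex.Im R \o g) \+
                      (@complex.Im R \o f) \* (@complex.Re R \o g)).
  by apply: measurable_funD; exact: measurable_funM.
by apply/funext => x /=; case: (f x) (g x) => ? ? [].
Qed.

Let cmeasJ f : cmeas f -> cmeas (fun x => (f x)^*%C).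
Proof.
move=> [f1 f2]; split.
  rewrite (_ : _ \o _ = @complex.Re R \o f)//.
  by apply/funext => x /=; case: (f x).
rewrite (_ : _ \o _ = \- (@complex.Im R \o f)).
  exact: measurableT_comp.
by apply/funext => x /=; case: (f x).
Qed.

Let cmeas_sum I (s : seq I) P (F : I -> T -> R[i]) :
  (forall i, cmeas (F i)) -> cmeas (fun x => \sum_(i <- s | P i) F i x).
Proof.
move=> mF; elim: s => [|i s IHs].
  by under [X in cmeas X]funext do rewrite big_nil; exact: cmeas_cst.
under [X in cmeas X]funext do rewrite big_cons.
by case: (P i) => //; exact: cmeasD.
Qed.

Let cmeas_prod I (s : seq I) P (F : I -> T -> R[i]) :
  (forall i, cmeas (F i)) -> cmeas (fun x => \prod_(i <- s | P i) F i x).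
Proof.
move=> mF; elim: s => [|i s IHs].
  by under [X in cmeas X]funext do rewrite big_nil; exact: cmeas_cst.
under [X in cmeas X]funext do rewrite big_cons.
by case: (P i) => //; exact: cmeasM.
Qed.

Lemma measurable_Re_det_gram (A : T -> 'M[R[i]]_N) :
  (forall i j, measurable_fun setT (fun x => complex.Re (A x i j))) ->
  (forall i j, measurable_fun setT (fun x => complex.Im (A x i j))) ->
  measurable_fun setT
    (fun x => complex.Re (\det (1%:M + A x *m (A x)^t*))).
Proof.
move=> mRe mIm.
have mA i j : cmeas (fun x => A x i j) by split; [exact: mRe|exact: mIm].
suff [] : cmeas (fun x => \det (1%:M + A x *m (A x)^t*)) by [].
rewrite /determinant; apply: cmeas_sum => s; apply: cmeasM => //.
apply: cmeas_prod => i.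
under [X in cmeas X]funext do rewrite !mxE.
apply: cmeasD => //; apply: cmeas_sum => k; apply: cmeasM => //.
by under [X in cmeas X]funext do rewrite !mxE; exact: cmeasJ.
Qed.

End measurability.

Lemma schur_density_ge0 lam z : 0 <= schur_density lam z.
Proof.
rewrite /schur_density mulr_ge0//.
  by do 2!apply: prodr_ge0 => ? _; exact: sqr_ge0.
by rewrite invr_ge0 exprn_even_ge0// mul2n odd_double.
Qed.

Let measurable_invr : measurable_fun setT (fun x : R => x^-1).
Proof.
rewrite -(setUv [set 0 : R]); apply/measurable_funU => //.
  exact: measurableC.
split; first exact: measurable_fun_set1.
apply: open_continuous_measurable_fun; first exact/closed_openC/closed_eq.
by move=> x /[!inE]/= /eqP x0; exact: inv_continuous.
Qed.

Lemma measurable_schur_density lam : measurable_fun setT (schur_density lam).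
Proof.
have mnth k : measurable_fun setT
    (fun z : 'C(N, 2).-tuple (planeT R) => nth (0 : R, 0 : R) z k).
  have [lk|gek] := ltnP k 'C(N, 2).
    rewrite (_ : (fun z => _) = (@tnth _ _ ^~ (Ordinal lk))).
      exact: measurable_tnth.
    by apply/funext => z; rewrite (tnth_nth (0 : R, 0 : R)).
  rewrite (_ : (fun z => _) = cst (0 : R, 0 : R)); first exact: measurable_cst.
  by apply/funext => z; rewrite nth_default// size_tuple.
apply: measurable_funM => //.
apply: (@measurableT_comp _ _ _ _ _ _ (fun x : R => x ^- (2 * N)%N)).
  by apply: (measurableT_comp measurable_invr); exact: measurable_funX.
have m1 : measurable_fun setT (fst : planeT R -> R) by exact: measurable_fst.
have m2 : measurable_fun setT (snd : planeT R -> R) by exact: measurable_snd.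
apply: measurable_Re_det_gram => i j;
  under [X in measurable_fun _ X]funext do rewrite mxE.
  case: (i == j); first exact: measurable_cst.
  case: (i < j)%N; last exact: measurable_cst.
  exact: (measurableT_comp m1 (mnth _)).
case: (i == j); first exact: measurable_cst.
case: (i < j)%N; last exact: measurable_cst.
exact: (measurableT_comp m2 (mnth _)).
Qed.

Section schur_cond.
Variable lam : 'I_N -> R[i].
Local Open Scope ereal_scope.

Let cond0 : schur_cond_unnormalized lam set0 = 0.
Proof. exact: integral_set0. Qed.

Let cond_ge0 B : 0 <= schur_cond_unnormalized lam B.
Proof. by apply: integral_ge0 => z _; rewrite lee_fin schur_density_ge0. Qed.

Let cond_sigma_additive : semi_sigma_additive (schur_cond_unnormalized lam).
Proof.
apply: semi_sigma_additive_nng_induced => [|z].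
  by apply/measurable_EFinP; exact: measurable_schur_density.
by rewrite lee_fin schur_density_ge0.
Qed.

HB.instance Definition _ := isMeasure.Build _ _ _
  (schur_cond_unnormalized lam) cond0 cond_ge0 cond_sigma_additive.

(* Conditional law, given that the diagonal is [lam], of the strictly
   upper-triangular entries. [mnormalize] would use its second argument only if
   the total mass were 0 or infinite. *)
Definition schur_cond : probability ('C(N, 2).-tuple (planeT R)) R :=
  mnormalize (schur_cond_unnormalized lam)
    (@dirac _ ('C(N, 2).-tuple (planeT R)) [tuple (0%R, 0%R) | _ < _] R).

End schur_cond.

(* [G] is a random matrix distributed as the spherical ensemble conditioned on
   its (labelled) spectrum being [lam]: [G = U T U^*] with [U] unitary, with an
   arbitrary joint law with [T], where [T] is upper triangular with diagonal
   [lam] and strictly upper-triangular part of law [schur_cond lam]. *)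
Definition sph_given_spectrum lam d (Om : measurableType d)
    (Q : probability Om R) (G : Om -> 'M[R[i]]_N) : Prop :=
  exists (U : Om -> 'M[R[i]]_N) (Z : {RV Q >-> 'C(N, 2).-tuple (planeT R)}),
    [/\ forall w, U w \is unitarymx,
        forall B, measurable B -> distribution Q Z B = schur_cond lam B
      & forall w, G w = U w *m schur_mx lam (Z w) *m (U w)^t*].

End schur.

Section iid.
Context d (Om : measurableType d) (R : realType) (P : probability Om R).

Definition mutually_independent (I : finType) (K : {set I})
    (X : I -> {RV P >-> R}) : Prop :=
  forall (J : {set I}) (B : I -> set R), J \subset K ->
    (forall i, measurable (B i)) ->
    P (\bigcap_(i in [set` J]) X i @^-1` B i) =
    (\prod_(i in J) P (X i @^-1` B i))%E.

Definition has_density (X : {RV P >-> R}) (f : R -> R) : Prop :=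
  forall B, measurable B ->
    distribution P X B = (\int[lebesgue_measure]_(x in B) (f x)%:E)%E.

End iid.

Definition overlap_factor_pdf {R : realType} (N : nat) (x : R) : R :=
  if 0 < x then (N + 1)%N%:R / (1 + x) ^+ (N + 2)%N else 0.

(* Main.v *)
Require Import Defs.
From HB Require Import structures.
From mathcomp Require Import all_boot all_order all_algebra.
From mathcomp Require Import sesquilinear spectral.
From mathcomp Require Import complex.
From mathcomp Require Import all_classical all_reals all_analysis measurable_realfun.
From mathcomp Require Import ring lra.

Set Implicit Arguments.
Unset Strict Implicit.
Unset Printing Implicit Defensive.

Import Order.TTheory GRing.Theory Num.Theory.
Import numFieldNormedType.Exports.

Local Open Scope classical_set_scope.
Local Open Scope ring_scope.

(* Let b = (1, b_2, ..., b_N) be the left eigenvector of the Schur form T for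
   lambda_1. Since e_1 is a right eigenvector, O_11 = |b|^2. Let T_n be the leading
   block of size n, b^(n) the truncation of b, O_n = |b^(n)|^2, and u the part above
   the diagonal of column n + 1. Then b_{n+1} = b^(n) u / (lambda_1 - lambda_{n+1}), and,
   with H = 1 + T_n T_n^* and a = 1 + |lambda_{n+1}|^2,
     det (1 + T_{n+1} T_{n+1}^* ) = a det (H + a^-1 u u^* ).
   The linear form u |-> b^(n) u is completed to unimodular coordinates of C^n.
   Integrating out the other n - 1 coordinates one by one, by Schur complements,
   shows that for the weight det (H + a^-1 u u^* )^-(N+n+1) the variable
   |b^(n) u|^2 is a (b^(n) H b^(n)^* ) X with X of density (N+1)/(1+x)^(N+2).
   Finally b^(n) T_n = lambda_1 b^(n) gives b^(n) H b^(n)^* = (1 + |lambda_1|^2) O_n,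
   so that O_{n+1} = O_n (1 + c_{n+1} X); the remaining factor is a multiple of
   det H^-(N+n), which starts the next step. *)

(** * Densities and affine changes of variables *)

(** The exponents explain why the factors are identically distributed. The weight starts with
    exponent 2N; integrating out a column of height n lowers it from N+n+1 to N+n, and what is left
    for the rescaled |b u|^2 is (1+s)^-(N+2), whatever n is. The height enters only through
    constants, and the eigenvalue of the column only through the scale c_{n+1}. Laws are handled
    through test functions: for every nonnegative measurable f, the mean of f(O_11) is, up to a
    constant, the mean of f along a multiplicative chain started at 1. The constants depend on the
    spectrum and on N but never on the entries still to be integrated. They are therefore left
    unevaluated, as is the area of the unit disk: taking f = 1 identifies their product with the
    total mass, and they cancel in the normalization. Independence of the X enters only at the end,
    to show that the mean of f over the product is computed by the same chain. *)

Notation pushforward_measure :=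
  measure_function_pushforward__canonical__measure_function_Measure.

Section density_integral.
Local Open Scope ereal_scope.
Context d (T : measurableType d) (R : realType).
Import HBNNSimple.

(** Monotone convergence along simple functions reduces the claim to their level sets, where it is
    the hypothesis on [nu A]. As [rho] is finite, multiplying by it preserves the limits. *)
Lemma ge0_integral_density (mu nu : {measure set T -> \bar R}) (rho : T -> R) :
  measurable_fun setT rho -> (forall x, (0 <= rho x)%R) ->
  (forall A, measurable A -> nu A = \int[mu]_(x in A) (rho x)%:E) ->
  forall f : T -> \bar R, measurable_fun setT f -> (forall x, 0 <= f x) ->
  \int[nu]_x f x = \int[mu]_x (f x * (rho x)%:E).
Proof.
move=> mrho rho0 nuE f mf f0; pose h := nnsfun_approx measurableT mf.
have mErho : measurable_fun setT (EFin \o rho) by exact/measurable_EFinP.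
have fE x : f x = limn (EFin \o h ^~ x).
  by apply/esym/cvg_lim => //; exact: cvg_nnsfun_approx.
transitivity (limn (fun n => \int[nu]_x (EFin \o h n) x)).
  under eq_integral do rewrite fE.
  apply: monotone_convergence => //.
  - by move=> n; exact/measurable_EFinP.
  - by move=> n x _; rewrite lee_fin.
  - by move=> x _ a b ab; rewrite lee_fin; exact/lefP/nd_nnsfun_approx.
transitivity (limn (fun n => \int[mu]_x ((EFin \o h n) x * (rho x)%:E))); last first.
  have fg x : f x * (rho x)%:E = limn (fun n => (EFin \o h n) x * (rho x)%:E).
    by apply/esym/cvg_lim => //; apply: cvgeZr => //; exact: cvg_nnsfun_approx.
  under [RHS]eq_integral do rewrite fg.
  apply/esym; apply: monotone_convergence => //.
  - by move=> n; apply: emeasurable_funM => //; exact/measurable_EFinP.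
  - by move=> n x _; rewrite mule_ge0 ?lee_fin.
  - move=> x _ a b ab; rewrite lee_wpmul2r ?lee_fin//.
    exact/lefP/nd_nnsfun_approx.
congr (limn _); apply/funext => n.
have mind (r : R) : measurable_fun setT (fun x => (\1_(h n @^-1` [set r]) x)%:E : \bar R).
  by exact/measurable_EFinP.
transitivity (\sum_(r \in range (h n)) r%:E * nu (h n @^-1` [set r])).
  rewrite integralT_nnsfun sintegralE.
  by apply: eq_fsbigr => r _.
transitivity (\sum_(r \in range (h n))
   \int[mu]_x ((r * \1_(h n @^-1` [set r]) x)%:E * (rho x)%:E)).
  apply: eq_fsbigr => r; rewrite inE => -[t _ tr].
  have r0 : (0 <= r)%R by rewrite -tr.
  under eq_integral do rewrite EFinM -muleA.
  rewrite ge0_integralZl//; last 2 first.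
  - by apply: emeasurable_funM.
  - by move=> x _; rewrite mule_ge0// lee_fin.
  rewrite nuE// integral_mkcond; congr (_ * _); apply: eq_integral => x _.
  by rewrite patchE indicE; case: ifPn => _; rewrite ?mul1e ?mul0e.
rewrite -ge0_integral_fsum//.
- apply: eq_integral => x _ /=; rewrite fimfunE -fsumEFin// ge0_mule_fsuml// => r.
  exact: nnfun_muleindic_ge0.
- move=> r; apply: emeasurable_funM => //.
  by apply/measurable_EFinP; exact: measurable_funM.
- by move=> r x _; rewrite mule_ge0 ?nnfun_muleindic_ge0 ?lee_fin.
Qed.

End density_integral.

Section lebesgue_affine.
Local Open Scope ereal_scope.
Context {R : realType}.
Local Notation mu := (@lebesgue_measure R).

Let affine (c d : R) (x : measurableTypeR R) : measurableTypeR R := (c * x + d)%R.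

Let measurable_affine c d : measurable_fun [set: measurableTypeR R] (affine c d).
Proof. by apply: measurable_funD => //; exact: measurable_funM. Qed.

(** By uniqueness of Lebesgue measure on half-open intervals, [mu] is [c] times its own image under
    the affine map. *)
Lemma ge0_integral_affine (c d : R) (f : measurableTypeR R -> \bar R) :
  (0 < c)%R -> measurable_fun setT f -> (forall x, 0 <= f x) ->
  \int[mu]_x f (c * x + d)%R = (c^-1)%:E * \int[mu]_x f x.
Proof.
move=> c0 mf f0.
have cE : (0 <= c)%R by exact: ltW.
pose aff := affine c d; have maff := measurable_affine c d.
pose nu0 : {measure set _ -> \bar R} := pushforward_measure mu maff.
pose nu := mscale (NngNum cE) nu0.
have nuE A : measurable A -> mu A = nu A.
  move=> mA; apply: lebesgue_measure_unique => // _ [[a b]] _ <-.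
  have E : nu `]a, b]%classic = c%:E * mu `](((a - d) / c)%R), (((b - d) / c)%R)]%classic.
    rewrite /nu /mscale/= /nu0/= /pushforward; congr (_ * mu _).
    apply/seteqP; split => x /=; rewrite !in_itv/= /aff /affine;
      by rewrite -ltrBlDr -lerBrDr ltr_pdivrMr// ler_pdivlMr// ![(x * _)%R]mulrC.
  apply: (eq_trans _ (esym E)).
  rewrite !lebesgue_measure_itv/= !lte_fin ltr_pM2r ?invr_gt0// ltrD2r.
  case: ifPn => ab; last by rewrite mule0.
  by rewrite -!EFinB -EFinM; congr EFin; field; rewrite gt_eqF.
have -> : \int[mu]_x f x = \int[nu]_x f x.
  by apply: eq_measure_integral => A mA _; exact: nuE.
rewrite ge0_integral_mscale// ge0_integral_pushforward//=.
rewrite muleA -EFinM mulVf ?gt_eqF// mul1e.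
by [].
Qed.

End lebesgue_affine.

(** * Lebesgue measure on the plane and its image under the squared norm *)

Section plane.
Local Open Scope ereal_scope.
Context {R : realType}.
Local Notation mu := (@lebesgue_measure R).
Local Notation plane := (planeT R).
Local Notation lebC := (@lebesgue_C R).

Lemma ge0_integral_plane (f : plane -> \bar R) :
  measurable_fun setT f -> (forall z, 0 <= f z) ->
  \int[lebC]_z f z = \int[mu]_x \int[mu]_y f (x, y).
Proof. by move=> mf f0; exact: (fubini_tonelli1 f mf f0). Qed.

Definition plane_affine (c : R) (w z : plane) : plane :=
  ((c * z.1 + w.1)%R, (c * z.2 + w.2)%R).

Lemma measurable_plane_affine c w : measurable_fun setT (plane_affine c w).
Proof.
apply/measurable_fun_pair => /=; apply: measurable_funD => //;
  apply: measurable_funM => //.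
Qed.

Lemma ge0_integral_plane_affine (c : R) (w : plane) (f : plane -> \bar R) :
  (0 < c)%R -> measurable_fun setT f -> (forall z, 0 <= f z) ->
  \int[lebC]_z f (plane_affine c w z) = (c ^- 2)%:E * \int[lebC]_z f z.
Proof.
move=> c0 mf f0.
have mfa : measurable_fun setT (f \o plane_affine c w).
  by apply: measurableT_comp => //; exact: measurable_plane_affine.
rewrite (ge0_integral_plane mfa (fun=> f0 _)) (ge0_integral_plane mf)//.
have mfx x : measurable_fun setT (fun y => f (x, y)) by exact: measurableT_comp.
pose g x := \int[mu]_y f (x, y).
have mg : measurable_fun setT g.
  exact: (@measurable_fun_fubini_tonelli_F _ _ _ _ _ mu f mf f0).
have g0 x : 0 <= g x by apply: integral_ge0.
transitivity (\int[mu]_x ((c^-1)%:E * g (c * x + w.1)%R)).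
  apply: eq_integral => x _ /=.
  by rewrite /plane_affine/= (ge0_integral_affine w.2 c0 (mfx _)).
rewrite ge0_integralZl//; last 2 first.
- apply: (measurableT_comp mg).
  by apply: measurable_funD => //; exact: measurable_funM.
- by rewrite lee_fin invr_ge0 ltW.
by rewrite (ge0_integral_affine w.1 c0 mg)// muleA -EFinM -invfM -expr2.
Qed.

Definition sqnorm_plane (z : plane) : measurableTypeR R := (z.1 ^+ 2 + z.2 ^+ 2)%R.

Lemma measurable_sqnorm_plane : measurable_fun setT sqnorm_plane.
Proof.
by apply: measurable_funD => //; apply: measurable_funX.
Qed.

Lemma sqnorm_plane_ge0 z : (0 <= sqnorm_plane z)%R.
Proof. by rewrite addr_ge0// sqr_ge0. Qed.

(** The parameter is the squared radius, which makes the area linear in it. *)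
Let disk (r : R) : set plane := sqnorm_plane @^-1` `]-oo, r].

Lemma mdisk r : measurable (disk r).
Proof.
by rewrite -[X in measurable X]setTI; exact: measurable_sqnorm_plane.
Qed.

#[local] Hint Extern 0 (measurable (disk _)) => exact: mdisk : core.

Lemma diskZ (r : R) : (0 < r)%R -> lebC (disk r) = r%:E * lebC (disk 1).
Proof.
move=> r0; have s0 : (0 < Num.sqrt r)%R by rewrite sqrtr_gt0.
have mind : measurable_fun setT (fun z => (\1_(disk r) z)%:E : \bar R).
  by apply/measurable_EFinP; exact: measurable_indic.
have /= := @ge0_integral_plane_affine (Num.sqrt r) (0%R, 0%R) _ s0 mind.
rewrite sqr_sqrtr; last exact: ltW.
rewrite (integral_indic _ _ (mdisk r))// setIT.
have -> : \int[lebC]_z (\1_(disk r) (plane_affine (Num.sqrt r) (0%R, 0%R) z))%:E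
    = lebC (disk 1).
  rewrite -[X in _ = lebC X](setIT (disk 1)) -(integral_indic _ _ (mdisk 1))//; apply: eq_integral => z _.
  rewrite !indicE; congr (_%:R%:E); congr nat_of_bool.
  have E : sqnorm_plane (plane_affine (Num.sqrt r) (0%R, 0%R) z) =
      (r * sqnorm_plane z)%R :> R.
    by rewrite /sqnorm_plane/= !addr0 !exprMn sqr_sqrtr ?ltW// mulrDr.
  apply/idP/idP; rewrite !inE/= /disk/= !in_itv/= E.
    by rewrite -[leRHS]mulr1 (ler_pM2l r0).
  by rewrite -[X in _ -> (_ <= X)%R]mulr1 (ler_pM2l r0).
move=> -> => [|z]; last by rewrite lee_fin.
by rewrite muleA -EFinM divff ?gt_eqF// mul1e.
Qed.

Lemma disk1_lty : lebC (disk 1) < +oo.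
Proof.
apply: (@le_lt_trans _ _ (lebC (`[(-1)%R, 1%R] `*` `[(-1)%R, 1%R])%classic)).
  apply: le_measure; rewrite ?inE//=; first exact: measurableX.
  move=> [x y]; rewrite /disk/= /sqnorm_plane/= !in_itv/= -!ler_norml => xy.
  have H (a : R) : (a ^+ 2 <= 1 -> `|a| <= 1)%R.
    by rewrite ler_norml => ?; apply/andP; split; nra.
  by split; apply: H; apply: le_trans xy; rewrite ?lerDl ?lerDr sqr_ge0.
rewrite /lebesgue_C product_measure1E//= !lebesgue_measure_itv/= lte_fin.
by case: ifP => _; rewrite ?mul0e// -EFinD -EFinM ltry.
Qed.

Lemma disk1_gt0 : 0 < lebC (disk 1).
Proof.
apply: (@lt_le_trans _ _ (lebC (`[0%R, (2^-1)%R] `*` `[0%R, (2^-1)%R])%classic)).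
  rewrite /lebesgue_C product_measure1E//= !lebesgue_measure_itv/= lte_fin.
  by rewrite invr_gt0 ltr0n/= -EFinD -EFinM lte_fin mulr_gt0 // subr0 invr_gt0.
apply: le_measure; rewrite ?inE//=; first exact: measurableX.
move=> [x y]; rewrite /disk/= /sqnorm_plane/= !in_itv/= => -[/andP[x0 x1] /andP[y0 y1]].
by nra.
Qed.

(** Only finiteness and positivity of this area matter; its value is absorbed in constants that
    cancel. *)
Lemma disk1_fin : exists a : R, lebC (disk 1) = a%:E.
Proof.
by exists (fine (lebC (disk 1))); rewrite fineK// ge0_fin_numE// disk1_lty.
Qed.

Lemma disk_le0 (r : R) : (r <= 0)%R -> lebC (disk r) = 0.
Proof.
move=> r0; apply/eqP; rewrite eq_le measure_ge0 andbT.
apply/lee_addgt0Pr => e e0; rewrite add0e.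
have [a aE] := disk1_fin.
have a0 : (0 < a)%R by rewrite -lte_fin -aE disk1_gt0.
(* As r <= 0, the set lies in every disk of positive parameter; this one has area exactly [e]. *)
apply: (@le_trans _ _ (lebC (disk (e / a)))).
  apply: le_measure; rewrite ?inE// => z; rewrite /disk/= !in_itv/= => zr.
  by rewrite (le_trans zr)// (le_trans r0)// ltW// divr_gt0.
by rewrite diskZ ?divr_gt0// aE -EFinM divfK// gt_eqF.
Qed.

Lemma lebesgue_C_annulus a (s t : R) : lebC (disk 1) = a%:E -> (s <= t)%R ->
  lebC (sqnorm_plane @^-1` `]s, t]) = a%:E * (Num.max t 0 - Num.max s 0)%:E.
Proof.
move=> aE st.
have diskE (r : R) : lebC (disk r) = a%:E * (Num.max r 0%R)%:E.
  have [r0|r0] := leP r 0%R; first by rewrite disk_le0// mule0.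
  by rewrite diskZ// aE muleC.
have -> : sqnorm_plane @^-1` `]s, t] = disk t `\` disk s.
  apply/seteqP; split => x /=; rewrite /disk/= !in_itv/=.
    by move=> /andP[sx ->]; split => //; apply/negP; rewrite -ltNge.
  by move=> [-> /negP]; rewrite -ltNge => ->.
have dlt : lebC (disk t) < +oo by rewrite diskE -EFinM ltry.
rewrite measureD//.
have -> : disk t `&` disk s = disk s.
  apply/setIidPr => x; rewrite /disk/= !in_itv/= => xs; exact: le_trans xs st.
rewrite [X in X - _]diskE [X in _ - X]diskE.
by rewrite -!EFinM -EFinB -mulrBr.
Qed.

(** Polar coordinates for radial functions: areas of annuli show that the squared norm maps planar
    Lebesgue measure to a multiple of Lebesgue measure on the half-line. *)
Lemma ge0_integral_sqnorm_plane : exists2 a : R, (0 < a)%R &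
  forall f : measurableTypeR R -> \bar R, measurable_fun setT f -> (forall x, 0 <= f x) ->
  \int[lebC]_z f (sqnorm_plane z) = a%:E * \int[mu]_(x in `[0%R, +oo[) f x.
Proof.
have [a aE] := disk1_fin.
have a0 : (0 < a)%R by rewrite -lte_fin -aE disk1_gt0.
exists a => // f mf f0.
have ai0 : (0 <= a^-1)%R by rewrite invr_ge0 ltW.
pose nu : {measure set _ -> \bar R} := pushforward_measure lebC measurable_sqnorm_plane.
pose D : set (measurableTypeR R) := `]-oo, 0%R[%classic.
have mD : measurable D by exact: measurable_itv.
pose nu1 := mscale (NngNum ai0) nu.
(* The image measure lives on the nonnegative half-line, whereas uniqueness of Lebesgue measure
   concerns the whole line. The negative half-line is therefore added by hand; it does not
   contribute once [f] is restricted to nonnegative arguments. *)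
pose nu2 := mrestr mu mD.
pose nu3 := measure_add nu1 nu2.
have nu3E A : measurable A -> mu A = nu3 A.
  move=> mA; apply: lebesgue_measure_unique => // _ [[s t]] _ <-.
  have E : nu3 `]s, t]%classic = a^-1%:E * lebC (sqnorm_plane @^-1` `]s, t]) +
      mu (`]s, t]%classic `&` D).
    by rewrite /nu3 measure_addE.
  apply: (eq_trans _ (esym E)).
  rewrite lebesgue_measure_itv/= lte_fin.
  have [st|ts] := ltP s t; last first.
    by rewrite set_itv_ge ?bnd_simp -?leNgt// preimage_set0 set0I !measure0 mule0 adde0.
  rewrite (lebesgue_C_annulus aE (ltW st)) -EFinM mulrA mulVf ?gt_eqF// mul1r.
  have [t0|t0] := ltP t 0%R.
    rewrite [X in mu X](_ : _ = `]s, t]%classic); last first.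
      apply/setIidPl => x; rewrite /D/= !in_itv/= => /andP[_ xt]; exact: le_lt_trans xt t0.
    rewrite lebesgue_measure_itv/= lte_fin st.
    by rewrite !max_r ?ltW// ?(lt_trans st)// subrr add0e.
  have [s0|s0] := ltP s 0%R.
    rewrite [X in mu X](_ : _ = `]s, 0%R[%classic); last first.
      apply/seteqP; split => x /=; rewrite /D/= !in_itv/=.
        by move=> [/andP[-> _] ->].
      by move=> /andP[sx x0]; rewrite sx x0; split => //; rewrite (le_trans (ltW x0)).
    rewrite lebesgue_measure_itv/= lte_fin s0.
    by rewrite -!EFinB -EFinD; congr EFin; lra.
  rewrite [X in mu X](_ : _ = set0) ?measure0 ?adde0 ?EFinB//.
  apply/seteqP; split => x //=; rewrite /D/= !in_itv/= => -[/andP[sx _] x0].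
  by move: (lt_trans sx x0); rewrite ltNge s0.
transitivity (a%:E * \int[mu]_x ((f \_ `[0%R, +oo[) x)); last by rewrite -integral_mkcond.
have -> : \int[mu]_x ((f \_ `[0%R, +oo[) x) = \int[nu3]_x ((f \_ `[0%R, +oo[) x).
  by apply: eq_measure_integral => A mA _; exact: nu3E.
have mfD : measurable_fun [set: measurableTypeR R] (f \_ `[0%R, +oo[%classic).
  apply/(measurable_restrictT f (measurable_itv _)).
  exact: measurable_funTS.
have fD0 x : 0 <= (f \_ `[0%R, +oo[%classic) x by apply: erestrict_ge0.
rewrite ge0_integral_measure_add//.
rewrite ge0_integral_mscale//.
have -> : \int[nu2]_x (f \_ `[0%R, +oo[) x = 0.
  rewrite (@ge0_integral_density _ _ _ mu nu2 (\1_D))//.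
  - apply: integral0_eq => x _; rewrite patchE indicE.
    have [x0|x0] := ltP x 0%R.
      case: ifPn => [|_]; last by rewrite mul0e.
      by rewrite inE/= in_itv/= andbT leNgt x0.
    rewrite (_ : x \in D = false) ?mule0//; apply/negbTE/negP.
    by rewrite inE/= /D/= in_itv/= ltNge x0.
  - move=> A mA; rewrite integral_indic//.
    by rewrite /nu2 /mrestr setIC.
rewrite adde0 muleA -EFinM divff ?gt_eqF// mul1e.
transitivity (\int[nu]_x (f \_ `[0%R, +oo[) x); last by [].
rewrite ge0_integral_pushforward//=; last exact: measurable_sqnorm_plane.
apply: eq_integral => z _ /=; rewrite patchE mem_set//=.
by rewrite in_itv/= sqnorm_plane_ge0.
Qed.

End plane.

Section inverse_power_integral.
Local Open Scope ereal_scope.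
Context {R : realType}.
Local Notation mu := (@lebesgue_measure R).

Lemma ge0_integral_itv0y_scale (c : R) (f : measurableTypeR R -> \bar R) :
  (0 < c)%R -> measurable_fun setT f -> (forall x, 0 <= f x) ->
  \int[mu]_(x in `[0%R, +oo[) f (c * x)%R =
  (c^-1)%:E * \int[mu]_(x in `[0%R, +oo[) f x.
Proof.
move=> c0 mf f0.
rewrite [in LHS]integral_mkcond [in RHS]integral_mkcond.
have mfD : measurable_fun [set: measurableTypeR R] (f \_ `[0%R, +oo[%classic).
  apply/(measurable_restrictT f (measurable_itv _)).
  exact: measurable_funTS.
have fD0 x : 0 <= (f \_ `[0%R, +oo[%classic) x by apply: erestrict_ge0.
rewrite -(ge0_integral_affine 0 c0 mfD)//; apply: eq_integral => x _.
rewrite !patchE addr0; congr (if _ then _ else _).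
by apply/idP/idP; rewrite !inE/= !in_itv/= !andbT pmulr_rge0.
Qed.

Lemma integral_itv0y_inv_expr (q : nat) :
  \int[mu]_(x in `[0%R, +oo[) ((1 + x) ^- q.+2)%:E = (q.+1%:R^-1)%:E.
Proof.
pose g (x : R) := ((1 + x)^-1)%R.
(* The antiderivative that vanishes at infinity, so that the integral is -F(0). *)
pose F (x : R) := (- q.+1%:R^-1 * (g x) ^+ q.+1)%R.
have x1 (x : R) : (0 <= x -> 1 + x != 0 :> R)%R.
  by move=> x0; rewrite gt_eqF// ltr_wpDr.
have cg (x : R) : (0 <= x)%R -> {for x, continuous g}.
  by move=> x0; apply: cvgV; [exact: x1|apply: cvgD; [exact: cvg_cst|exact: cvg_id]].
have cgX (x : R) n : (0 <= x)%R -> {for x, continuous (fun x => g x ^+ n)%R}.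
  move=> x0; exact: (continuous_comp (cg _ x0) (@exprn_continuous _ n _)).
have dg (x : R) : (0 <= x)%R -> is_derive x 1%R g (- (g x) ^+ 2)%R.
  move=> x0.
  have d1 : is_derive x 1%R (fun y : R => 1 + y)%R 1%R.
    rewrite (_ : (fun y => _) = shift (1%R : R)); first exact: is_derive_shift.
    by apply/funext => y; rewrite /= addrC.
  apply: DeriveDef; first by apply: derivableV => //; exact: x1.
  rewrite deriveV//; last exact: x1.
  by rewrite derive_val [LHS]mulr1 /g exprVn.
have dF (x : R) : (0 <= x)%R -> is_derive x 1%R F ((1 + x) ^- q.+2)%R.
  move=> x0; have dgx := dg _ x0.
  rewrite (_ : F = - q.+1%:R^-1 *: (g ^+ q.+1))%R; last first.
    by rewrite exprfctE; apply/funext => y.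
  apply: is_derive_eq; rewrite /= /GRing.scale/= /g !exprVn.
  have q0 : q.+1%:R != 0%R :> R by rewrite pnatr_eq0.
  have H (c u v : R) : (c != 0 -> - c^-1 * (c * v * - u) = v * u)%R.
    by move=> c0; field.
  apply: (eq_trans (H _ _ _ q0)).
  by rewrite -invfM -exprD addn2.
have F0 : F x @[x --> +oo%R] --> 0%R.
  rewrite -[X in _ --> X](mulr0 (- q.+1%:R^-1)%R); apply: cvgM; first exact: cvg_cst.
  have gy : g x @[x --> +oo%R] --> (0 : R)%R.
    apply/(@gtr0_cvgV0 R R +oo%R _ (fun x => 1 + x)%R); last exact: cvg_addrl.
    near=> x; rewrite ltr_wpDr//; near: x; exact: nbhs_pinfty_ge.
  have := cvg_comp _ _ gy (@exprn_continuous _ q.+1 0%R).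
  by rewrite expr0n/=; apply.
rewrite (ge0_continuous_FTC2y _ _ F0).
- rewrite /F /g addr0 invr1 expr1n mulr1 -EFinB; congr EFin; rewrite sub0r opprK//.
- by move=> x x0; rewrite invr_ge0 exprn_ge0// addr_ge0.
- apply: continuous_in_subspaceT => x; rewrite inE/= in_itv/= andbT => x0.
  under eq_fun do rewrite -exprVn; exact: cgX.
- by move=> x x0; have := dF _ (ltW x0).
- apply: cvg_at_right_filter; apply: cvgM; first exact: cvg_cst.
  exact: cgX.
- by move=> x; rewrite in_itv/= andbT => x0; have dFx := dF _ (ltW x0); rewrite derive1E derive_val.
Unshelve. all: by end_near. Qed.

End inverse_power_integral.

(** * Iterated integrals and measurability of matrix-valued maps *)

Section iterated_integral.
Local Open Scope ereal_scope.
Context d (T : measurableType d) (R : realType).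
Variable mu : {sigma_finite_measure set T -> \bar R}.

(* The integrand is a function of a [seq], so that the variables can be split
   without casting tuples. *)
Fixpoint iterated_integral n (f : seq T -> \bar R) : \bar R :=
  if n is m.+1 then \int[mu]_x iterated_integral m (fun t => f (x :: t))
  else f [::].

Lemma iterated_integral_cat m n f : iterated_integral (m + n) f =
  iterated_integral m (fun s => iterated_integral n (fun t => f (s ++ t))).
Proof.
by elim: m f => //= m IHm f; apply: eq_integral => x _; rewrite IHm.
Qed.

Lemma eq_iterated_integral n f g : (forall s, size s = n -> f s = g s) ->
  iterated_integral n f = iterated_integral n g.
Proof.
elim: n f g => /= [f g ->//|n IHn f g fg].
by apply: eq_integral => x _; apply: IHn => s sn; apply: fg; rewrite /= sn.
Qed.

Lemma ge0_integral_tuple_cons n (f : n.+1.-tuple T -> \bar R) :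
  measurable_fun setT f -> (forall t, 0 <= f t) ->
  \int[tuple_measure mu n.+1]_t f t =
  \int[mu]_x \int[tuple_measure mu n]_t f (cons_pair (x, t)).
Proof.
move=> mf f0.
rewrite [LHS](_ : _ = \int[pushforward (mu \x tuple_measure mu n) (@cons_pair _ T n)]_t f t)//.
rewrite ge0_integral_pushforward//; last exact: measurable_cons_pair.
rewrite preimage_setT.
apply: (@fubini_tonelli1 _ _ _ _ _ mu (tuple_measure mu n) (f \o @cons_pair _ T n)) => [|x].
  by apply: measurableT_comp => //; exact: measurable_cons_pair.
exact: f0.
Qed.

Lemma measurable_tuple_cons n (f : n.+1.-tuple T -> \bar R) x :
  measurable_fun setT f -> measurable_fun setT (fun t : n.-tuple T => f (cons_pair (x, t))).
Proof.
move=> mf; apply: (@measurableT_comp _ _ _ _ _ _ f _ (fun t => cons_pair (x, t))) => //.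
apply: (@measurableT_comp _ _ _ _ _ _ (@cons_pair _ T n) _ (fun t => (x, t))) => //.
  exact: measurable_cons_pair.
exact: pair1_measurable.
Qed.

Lemma ge0_integral_tuple n (f : seq T -> \bar R) :
  measurable_fun setT (fun t : n.-tuple T => f t) -> (forall s, 0 <= f s) ->
  \int[tuple_measure mu n]_t f (t : n.-tuple T) = iterated_integral n f.
Proof.
elim: n f => [|n IHn] f mf f0 /=.
  rewrite [LHS](_ : _ = \int[\d_[tuple]]_t f (t : 0.-tuple T))//.
  by rewrite integral_dirac// diracT mul1e.
rewrite (ge0_integral_tuple_cons mf)//; apply: eq_integral => x _.
rewrite -IHn//; exact: (measurable_tuple_cons x mf).
Qed.

Lemma measurable_integral_tuple_cons n (f : n.+1.-tuple T -> \bar R) :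
  measurable_fun setT f -> (forall t, 0 <= f t) ->
  measurable_fun setT (fun x => \int[tuple_measure mu n]_t f (cons_pair (x, t))).
Proof.
move=> mf f0.
apply: (@measurable_fun_fubini_tonelli_F _ _ _ _ _ (tuple_measure mu n) (f \o @cons_pair _ T n)) => [|x].
  by apply: measurableT_comp => //; exact: measurable_cons_pair.
exact: f0.
Qed.

Lemma integral_tuple_cons_swap n (f : n.+1.-tuple T -> \bar R) :
  measurable_fun setT f -> (forall t, 0 <= f t) ->
  \int[mu]_x \int[tuple_measure mu n]_t f (cons_pair (x, t)) =
  \int[tuple_measure mu n]_t \int[mu]_x f (cons_pair (x, t)).
Proof.
move=> mf f0.
apply: (@fubini_tonelli _ _ _ _ _ mu (tuple_measure mu n) (f \o @cons_pair _ T n)) => [|x].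
  by apply: measurableT_comp => //; exact: measurable_cons_pair.
exact: f0.
Qed.

End iterated_integral.

Section complex_measurability.
Context {R : realType}.
Local Open Scope sesquilinear_scope.

Section def.
Context d (T : measurableType d).

Definition cmeasurable (f : T -> R[i]) :=
  measurable_fun setT (@complex.Re R \o f) /\
  measurable_fun setT (@complex.Im R \o f).

Lemma cmeasurable_cst c : cmeasurable (fun=> c).
Proof. by split; exact: measurable_cst. Qed.

Lemma cmeasurableD f g : cmeasurable f -> cmeasurable g ->
  cmeasurable (fun x => f x + g x).
Proof.
move=> [f1 f2] [g1 g2]; split.
- apply: (eq_measurable_fun ((@complex.Re R \o f) \+ (@complex.Re R \o g))).
    by move=> x _ /=; case: (f x) (g x) => ? ? [].
  exact: measurable_funD.
- apply: (eq_measurable_fun ((@complex.Im R \o f) \+ (@complex.Im R \o g))).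
    by move=> x _ /=; case: (f x) (g x) => ? ? [].
  exact: measurable_funD.
Qed.

Lemma cmeasurableM f g : cmeasurable f -> cmeasurable g ->
  cmeasurable (fun x => f x * g x).
Proof.
move=> [f1 f2] [g1 g2]; split.
- apply: (eq_measurable_fun ((@complex.Re R \o f) \* (@complex.Re R \o g) \-
    (@complex.Im R \o f) \* (@complex.Im R \o g))).
    by move=> x _ /=; case: (f x) (g x) => ? ? [].
  by apply: measurable_funB; exact: measurable_funM.
- apply: (eq_measurable_fun ((@complex.Re R \o f) \* (@complex.Im R \o g) \+
    (@complex.Im R \o f) \* (@complex.Re R \o g))).
    by move=> x _ /=; case: (f x) (g x) => ? ? [].
  by apply: measurable_funD; exact: measurable_funM.
Qed.

Lemma cmeasurable_conj f : cmeasurable f -> cmeasurable (fun x => (f x)^*%R).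
Proof.
move=> [f1 f2]; split.
- apply: (eq_measurable_fun (@complex.Re R \o f)) => //.
  by move=> x _ /=; case: (f x).
- apply: (eq_measurable_fun (\- (@complex.Im R \o f))).
    by move=> x _ /=; case: (f x).
  exact: measurableT_comp.
Qed.

Lemma cmeasurable_sum I (s : seq I) (P : pred I) (F : I -> T -> R[i]) :
  (forall i, P i -> cmeasurable (F i)) ->
  cmeasurable (fun x => \sum_(i <- s | P i) F i x).
Proof.
move=> mF; elim: s => [|i s IHs].
  under [X in cmeasurable X]funext do rewrite big_nil; exact: cmeasurable_cst.
under [X in cmeasurable X]funext do rewrite big_cons.
have [Pi|] := boolP (P i) => //; apply: cmeasurableD => //; exact: mF.
Qed.

Lemma cmeasurable_prod I (s : seq I) (P : pred I) (F : I -> T -> R[i]) :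
  (forall i, P i -> cmeasurable (F i)) ->
  cmeasurable (fun x => \prod_(i <- s | P i) F i x).
Proof.
move=> mF; elim: s => [|i s IHs].
  under [X in cmeasurable X]funext do rewrite big_nil; exact: cmeasurable_cst.
under [X in cmeasurable X]funext do rewrite big_cons.
have [Pi|] := boolP (P i) => //; apply: cmeasurableM => //; exact: mF.
Qed.

Definition cmeasurable_mx m n (A : T -> 'M[R[i]]_(m, n)) :=
  forall i j, cmeasurable (fun x => A x i j).

Lemma cmeasurable_mx_cst m n (A : 'M[R[i]]_(m, n)) : cmeasurable_mx (fun=> A).
Proof. by move=> i j; exact: cmeasurable_cst. Qed.

Lemma cmeasurable_mxD m n (A B : T -> 'M[R[i]]_(m, n)) :
  cmeasurable_mx A -> cmeasurable_mx B -> cmeasurable_mx (fun x => A x + B x).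
Proof.
move=> mA mB i j; under [X in cmeasurable X]funext do rewrite mxE.
exact: cmeasurableD.
Qed.

Lemma cmeasurable_mxZ m n (a : R[i]) (A : T -> 'M[R[i]]_(m, n)) :
  cmeasurable_mx A -> cmeasurable_mx (fun x => a *: A x).
Proof.
move=> mA i j; under [X in cmeasurable X]funext do rewrite mxE.
by apply: cmeasurableM => //; exact: cmeasurable_cst.
Qed.

Lemma cmeasurable_mulmx m n p (A : T -> 'M[R[i]]_(m, n)) (B : T -> 'M[R[i]]_(n, p)) :
  cmeasurable_mx A -> cmeasurable_mx B -> cmeasurable_mx (fun x => A x *m B x).
Proof.
move=> mA mB i j; under [X in cmeasurable X]funext do rewrite mxE.
by apply: cmeasurable_sum => k _; exact: cmeasurableM.
Qed.

Lemma cmeasurable_conjtr m n (A : T -> 'M[R[i]]_(m, n)) :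
  cmeasurable_mx A -> cmeasurable_mx (fun x => (A x)^t*).
Proof.
move=> mA i j; under [X in cmeasurable X]funext do rewrite !mxE.
exact: cmeasurable_conj.
Qed.

Lemma cmeasurable_det n (A : T -> 'M[R[i]]_n) :
  cmeasurable_mx A -> cmeasurable (fun x => \det (A x)).
Proof.
move=> mA; rewrite /determinant; apply: cmeasurable_sum => s _.
by apply: cmeasurableM; [exact: cmeasurable_cst|exact: cmeasurable_prod].
Qed.

Lemma measurable_inv_expr (f : T -> R) n :
  measurable_fun setT f -> measurable_fun setT (fun x => f x ^- n).
Proof.
move=> mf; apply: (@measurableT_comp _ _ _ _ _ _ (fun y : R => y^-1)).
  rewrite -(setUv [set 0 : R]); apply/measurable_funU => //.
    exact: measurableC.
  split; first exact: measurable_fun_set1.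
  apply: open_continuous_measurable_fun; first exact/closed_openC/closed_eq.
  by move=> x /[!inE]/= /eqP x0; exact: inv_continuous.
exact: measurable_funX.
Qed.

End def.
End complex_measurability.

(** * Positive definite Hermitian matrices *)

Section positive_definite.
Local Open Scope sesquilinear_scope.

Lemma det_block_scalar (F : fieldType) m (a : F) (b : 'rV[F]_m) (c : 'cV[F]_m) (D : 'M[F]_m) :
  a != 0 -> \det (block_mx a%:M b c D) = a * \det (D - a^-1 *: (c *m b)).
Proof.
move=> a0.
have E : block_mx 1%:M 0 (- a^-1 *: c) 1%:M *m block_mx a%:M b c D =
    block_mx a%:M b 0 (D - a^-1 *: (c *m b)).
  rewrite mulmx_block !mul1mx !mul0mx !addr0 mul_mx_scalar scalerA mulrN mulfV// scaleN1r addNr.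
  by rewrite -scalemxAl scaleNr addrC.
move/(congr1 (@determinant _ _)) : E.
by rewrite det_mulmx det_lblock !det1 !mul1r det_ublock det_scalar1.
Qed.

Variable C : numClosedFieldType.
Implicit Types m n : nat.

Lemma conjtr_mulmx m n p (A : 'M[C]_(m, n)) (B : 'M[C]_(n, p)) :
  (A *m B)^t* = B^t* *m A^t*.
Proof. by rewrite trmx_mul map_mxM. Qed.

Lemma conjtrD m n (A B : 'M[C]_(m, n)) : (A + B)^t* = A^t* + B^t*.
Proof. by apply/matrixP => i j; rewrite !mxE rmorphD. Qed.

Lemma conjtrB m n (A B : 'M[C]_(m, n)) : (A - B)^t* = A^t* - B^t*.
Proof. by apply/matrixP => i j; rewrite !mxE rmorphB. Qed.

Lemma conjtrZ m n (a : C) (A : 'M[C]_(m, n)) : (a *: A)^t* = a^* *: A^t*.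
Proof. by apply/matrixP => i j; rewrite !mxE rmorphM. Qed.

Lemma conjtr1 n : (1%:M : 'M[C]_n)^t* = 1%:M.
Proof. by rewrite trmx1 map_mx1. Qed.

Definition posdefmx n (H : 'M[C]_n) :=
  H^t* = H /\ forall v : 'rV_n, v != 0 -> 0 < (v *m H *m v^t*) 0 0.

Lemma mulmx_conjtr_ge0 n (v : 'rV[C]_n) : 0 <= (v *m v^t*) 0 0.
Proof. by rewrite mxE sumr_ge0// => j _; rewrite !mxE mul_conjC_ge0. Qed.

Lemma mulmx_conjtr_gt0 n (v : 'rV[C]_n) : v != 0 -> 0 < (v *m v^t*) 0 0.
Proof.
move=> v0; rewrite lt_def mulmx_conjtr_ge0 andbT; apply: contra_neq v0.
rewrite mxE => /eqP; rewrite psumr_eq0 => [/allP v0|j _]; last by rewrite !mxE mul_conjC_ge0.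
apply/rowP => j; rewrite mxE.
by have /implyP/(_ isT) := v0 j (mem_index_enum _); rewrite !mxE mul_conjC_eq0 => /eqP.
Qed.

Lemma posdefmx_gram m n (A : 'M[C]_(m, n)) : posdefmx (1%:M + A *m A^t*).
Proof.
split; first by rewrite conjtrD conjtr1 conjtr_mulmx trmxCK.
move=> v v0; rewrite mulmxDr mulmx1 mulmxDl mxE ltr_wpDr ?mulmx_conjtr_gt0//.
by rewrite mulmxA -mulmxA -conjtr_mulmx mulmx_conjtr_ge0.
Qed.

Lemma posdefmx_congr n (A H : 'M[C]_n) : A \in unitmx ->
  posdefmx H -> posdefmx (A *m H *m A^t*).
Proof.
move=> uA [hH pH]; split; first by rewrite !conjtr_mulmx trmxCK hH mulmxA.
move=> v v0; have -> : v *m (A *m H *m A^t*) *m v^t* = (v *m A) *m H *m (v *m A)^t*.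
  by rewrite conjtr_mulmx !mulmxA.
apply: pH.
by apply: contra_neq v0 => vA; rewrite -(mulmxK uA v) vA mul0mx.
Qed.

Section schur_complement.
Variables (m : nat) (H : 'M[C]_(1 + m)).

Definition schur_complement : 'M[C]_m :=
  drsubmx H - (H 0 0)^-1 *: (dlsubmx H *m ursubmx H).

Lemma ulsubmx11 : ulsubmx H = (H 0 0)%:M.
Proof. by rewrite [LHS]mx11_scalar !mxE !lshift0. Qed.

Lemma det_schur_complement : H 0 0 != 0 -> \det H = H 0 0 * \det schur_complement.
Proof.
by move=> h0; rewrite -[in LHS](submxK H) ulsubmx11 det_block_scalar.
Qed.

Hypothesis pH : posdefmx H.

Lemma posdefmx00 : 0 < H 0 0.
Proof.
have /= := pH.2 (delta_mx 0 0); rewrite -rowE.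
have -> : (row 0 H *m (delta_mx 0 0 : 'rV_(1 + m))^t*) 0 0 = H 0 0.
  rewrite mxE (bigD1 ord0)//= !mxE !eqxx conjC1 mulr1 big1 ?addr0// => j j0.
  by rewrite !mxE eqxx (negPf j0) conjC0 mulr0.
apply; apply/eqP => /matrixP/(_ 0 0); rewrite !mxE !eqxx => /eqP.
by rewrite oner_eq0.
Qed.

Lemma conjtr_ursubmx : (ursubmx H)^t* = dlsubmx H.
Proof. by rewrite trmx_ursub map_dlsubmx pH.1. Qed.

Lemma conjtr_dlsubmx : (dlsubmx H)^t* = ursubmx H.
Proof. by rewrite trmx_dlsub map_ursubmx pH.1. Qed.

Lemma conj_posdefmx00 : (H 0 0)^* = H 0 0.
Proof. by rewrite conj_Creal// gtr0_real// posdefmx00. Qed.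

(** The form of the complement at v is the form of H at (y, v), where y is chosen to cancel the
    first entry of (y, v) H. *)
Lemma posdefmx_schur_complement : posdefmx schur_complement.
Proof.
have h0 := posdefmx00; have hn0 : H 0 0 != 0 by rewrite gt_eqF.
split.
  rewrite /schur_complement -scaleNr conjtrD conjtrZ conjtr_mulmx conjtr_ursubmx conjtr_dlsubmx.
  have -> : (- (H 0 0)^-1)^* = - (H 0 0)^-1.
    by rewrite conj_Creal// rpredN rpredV gtr0_real.
  by rewrite trmx_drsub map_drsubmx pH.1.
move=> v v0; pose s := v *m dlsubmx H.
pose y : 'rV_1 := - (H 0 0)^-1 *: s.
have := pH.2 (row_mx y v).
have -> : row_mx y v *m H = row_mx 0 (v *m schur_complement).
  rewrite -[in LHS](submxK H) mul_row_block ulsubmx11.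
  congr row_mx.
    by rewrite mul_mx_scalar scalerA mulrN mulfV// scaleN1r addNr.
  rewrite /schur_complement mulmxBr addrC; congr (_ + _).
  by rewrite /y -scalemxAl scaleNr -scalemxAr mulmxA.
have -> : (row_mx y v)^t* = col_mx (y^t*) (v^t*) by rewrite tr_row_mx map_col_mx.
rewrite mul_row_col mul0mx add0r; apply.
apply: contra_neq v0.
by rewrite -[X in _ = X]row_mx0 => /eq_row_mx[_].
Qed.

(** Eliminating the corner from a rank-one update leaves a rank-one update of the Schur complement:
    the vector is translated by an amount that depends on x but not on v, and the coefficient is
    rescaled by h/a with h the corner of H. The integral over v is thus of the same kind in one
    dimension less, which drives the induction. *)
Lemma det_rank_one_update (k x : C) (v : 'cV_m) :
  let a := H 0 0 + k * (x * x^*) in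
  let w := v - (x / H 0 0) *: dlsubmx H in
  let u := col_mx x%:M v in a != 0 ->
  \det (H + k *: (u *m u^t*)) =
  a * \det (schur_complement + (k * H 0 0 / a) *: (w *m w^t*)).
Proof.
move=> a w u a0; have h0 : H 0 0 != 0 by rewrite gt_eqF// posdefmx00.
rewrite -[in LHS](submxK H) ulsubmx11.
have -> : u *m u^t* = block_mx (x * x^*)%:M (x *: v^t*) (x^* *: v) (v *m v^t*).
  rewrite /u tr_col_mx map_row_mx mul_col_row tr_scalar_mx map_scalar_mx.
  by rewrite -scalar_mxM mul_scalar_mx mul_mx_scalar.
rewrite scale_block_mx add_block_mx scale_scalar_mx -raddfD/= det_block_scalar//.
congr (_ * \det _); rewrite /w /schur_complement.
have -> : (v - (x / H 0 0) *: dlsubmx H)^t* = v^t* - (x^* / H 0 0) *: ursubmx H.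
  rewrite conjtrB conjtrZ conjtr_dlsubmx; congr (_ - _ *: _).
  by rewrite rmorphM/= fmorphV/= [X in _ / X]conj_posdefmx00.
apply/matrixP => i j; rewrite !(mxE, big_ord1) -/a.
set p := H (rshift _ i) _; set q := H _ (rshift _ j); set D := H _ _.
rewrite /a in a0 *.
by field; rewrite h0 a0.
Qed.

End schur_complement.

Lemma posdefmx_det_gt0 n (H : 'M[C]_n) : posdefmx H -> 0 < \det H.
Proof.
elim: n H => [|n IHn] H pH; first by rewrite det_mx00.
rewrite (@det_schur_complement n) ?gt_eqF ?posdefmx00// mulr_gt0 ?posdefmx00//.
by apply/IHn/posdefmx_schur_complement.
Qed.

End positive_definite.

(** * Integrals over a complex column *)

Section column_integral.
Local Open Scope sesquilinear_scope.
Context {R : realType}.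
Local Notation C := R[i].
Local Notation plane := (planeT R).
Local Notation lebC := (@lebesgue_C R).
Local Notation mu := (@lebesgue_measure R).

Definition complex_of_plane (z : plane) : C := Complex (z.1 : R) (z.2 : R).

Definition sqnormc (z : C) : R := complex.Re z ^+ 2 + complex.Im z ^+ 2.

Definition col_of_planes m (s : seq plane) : 'cV[C]_m :=
  \col_(i < m) complex_of_plane (nth (0 : R, 0 : R) s i).

(* Matrix types carry no measurable structure. *)
Definition mx_measurable m n (phi : 'M[C]_(m, n) -> \bar R) :=
  forall d (T : measurableType d) (U : T -> 'M[C]_(m, n)),
    cmeasurable_mx U -> measurable_fun setT (fun x => phi (U x)).

Definition integral_cV m (phi : 'cV[C]_m -> \bar R) : \bar R :=
  (\int[tuple_measure lebC m]_t phi (col_of_planes m t))%E.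

Lemma cmeasurable_complex_of_plane : cmeasurable complex_of_plane.
Proof. by split; [exact: measurable_fst|exact: measurable_snd]. Qed.

Lemma cmeasurable_comp d1 d2 (T1 : measurableType d1) (T2 : measurableType d2)
  (f : T2 -> C) (g : T1 -> T2) : cmeasurable f -> measurable_fun setT g ->
  cmeasurable (f \o g).
Proof.
by move=> [f1 f2] mg; split; [exact: (measurableT_comp f1)|exact: (measurableT_comp f2)].
Qed.

Lemma cmeasurable_nth m i :
  cmeasurable (fun t : m.-tuple plane => complex_of_plane (nth (0 : R, 0 : R) t i)).
Proof.
have [im|mi] := ltnP i m.
  rewrite (_ : (fun _ => _) = complex_of_plane \o (@tnth _ _ ^~ (Ordinal im))).
    by apply: cmeasurable_comp; [exact: cmeasurable_complex_of_plane|exact: measurable_tnth].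
  by apply/funext => t; rewrite /= (tnth_nth (0 : R, 0 : R)).
rewrite (_ : (fun _ => _) = (fun=> complex_of_plane (0 : R, 0 : R))).
  exact: cmeasurable_cst.
by apply/funext => t; rewrite nth_default// size_tuple.
Qed.

Lemma cmeasurable_col_of_planes m :
  cmeasurable_mx (fun t : m.-tuple plane => col_of_planes m t).
Proof.
by move=> i j; under [X in cmeasurable X]funext do rewrite mxE; exact: cmeasurable_nth.
Qed.

Lemma cmeasurable_scalar_mx d (T : measurableType d) (f : T -> C) n :
  cmeasurable f -> cmeasurable_mx (fun x => (f x)%:M : 'M[C]_n).
Proof.
move=> mf i j; under [X in cmeasurable X]funext do rewrite mxE.
by case: (i == j) => //; exact: cmeasurable_cst.
Qed.

Lemma cmeasurable_col_mx d (T : measurableType d) m1 m2 n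
  (A : T -> 'M[C]_(m1, n)) (B : T -> 'M[C]_(m2, n)) :
  cmeasurable_mx A -> cmeasurable_mx B -> cmeasurable_mx (fun x => col_mx (A x) (B x)).
Proof.
move=> mA mB i j; under [X in cmeasurable X]funext do rewrite mxE.
by case: (fintype.split i) => k.
Qed.

Lemma measurable_sqnormc d (T : measurableType d) (f : T -> C) :
  cmeasurable f -> measurable_fun setT (fun x => sqnormc (f x) : measurableTypeR R).
Proof.
by move=> [f1 f2]; apply: measurable_funD; exact: measurable_funX.
Qed.

Lemma sqnormc_complex_of_plane z : sqnormc (complex_of_plane z) = sqnorm_plane z.
Proof. by []. Qed.

Lemma sqnormcE (z : C) : z * z^* = (sqnormc z)%:C%C.
Proof.
by case: z => a b; rewrite /sqnormc; simpc; rewrite -!expr2; congr Complex; ring.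
Qed.

Lemma col_of_planes_cons m x (s : seq plane) :
  col_of_planes m.+1 (x :: s) =
  col_mx (complex_of_plane x)%:M (col_of_planes m s) :> 'cV_(1 + m).
Proof.
apply/colP => i; rewrite [RHS]mxE; case: splitP => j ij; rewrite !mxE ij.
  by rewrite !ord1.
by [].
Qed.

Lemma integral_cV0 (phi : 'cV[C]_0 -> \bar R) :
  mx_measurable phi -> integral_cV phi = phi 0.
Proof.
move=> mphi; rewrite /integral_cV.
rewrite [LHS](_ : _ = \int[\d_[tuple]]_t phi (col_of_planes 0 (t : 0.-tuple plane)))%E//.
rewrite integral_dirac// ?diracT ?mul1e.
  by congr phi; apply/colP => -[].
by apply: mphi; exact: cmeasurable_col_of_planes.
Qed.

Section step.
Variables (m : nat) (phi : 'cV[C]_(1 + m) -> \bar R).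
Hypotheses (mphi : mx_measurable phi) (phi0 : forall v, (0 <= phi v)%E).

Let f (t : m.+1.-tuple plane) := phi (col_of_planes m.+1 t).

Let mf : measurable_fun setT f.
Proof. by apply: mphi; exact: cmeasurable_col_of_planes. Qed.

Lemma integral_cVS : @integral_cV m.+1 phi =
  (\int[lebC]_x integral_cV (fun v => phi (col_mx (complex_of_plane x)%:M v)))%E.
Proof.
rewrite [LHS](ge0_integral_tuple_cons lebC mf (fun=> phi0 _)); apply: eq_integral => x _.
by apply: eq_integral => t _; rewrite /f/= col_of_planes_cons.
Qed.

Lemma measurable_integral_cV : measurable_fun setT (fun x =>
  integral_cV (fun v => phi (col_mx (complex_of_plane x)%:M v))).
Proof.
apply: (eq_measurable_fun _ _ (measurable_integral_tuple_cons lebC mf (fun=> phi0 _))).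
by move=> x _; apply: eq_integral => t _; rewrite /f/= col_of_planes_cons.
Qed.

Lemma integral_cV_swap :
  (\int[lebC]_x integral_cV (fun v => phi (col_mx (complex_of_plane x)%:M v)) =
  integral_cV (fun v => \int[lebC]_x phi (col_mx (complex_of_plane x)%:M v)))%E.
Proof.
transitivity (\int[lebC]_x \int[tuple_measure lebC m]_t f (cons_pair (x, t)))%E.
  apply: eq_integral => x _.
  by apply: eq_integral => t _; rewrite /f/= col_of_planes_cons.
rewrite (integral_tuple_cons_swap lebC mf (fun=> phi0 _)); apply: eq_integral => t _.
by apply: eq_integral => x _; rewrite /f/= col_of_planes_cons.
Qed.

End step.

Lemma integral_complex_shift (c : C) (f : plane -> \bar R) :
  measurable_fun setT f -> (forall x, 0 <= f x)%E ->
  (\int[lebC]_x f (x.1 + complex.Re c, x.2 + complex.Im c)%R = \int[lebC]_x f x)%E.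
Proof.
move=> mf f0.
have := @ge0_integral_plane_affine R 1 (complex.Re c, complex.Im c) f ltr01 mf f0.
rewrite expr1n invr1 mul1e => <-.
by apply: eq_integral => x _; rewrite /plane_affine/= !mul1r.
Qed.

Lemma complex_of_plane_shift (c : C) (x : plane) :
  complex_of_plane (x.1 + complex.Re c, x.2 + complex.Im c) = complex_of_plane x + c.
Proof. by case: c => a b; rewrite /complex_of_plane/=. Qed.

Lemma integral_cV_shift m (phi : 'cV[C]_m -> \bar R) (w : 'cV_m) :
  mx_measurable phi -> (forall v, 0 <= phi v)%E ->
  integral_cV (fun v => phi (v + w)) = integral_cV phi.
Proof.
elim: m phi w => [|m IHm] phi w mphi phi0.
  by apply: eq_integral => t _; congr phi; apply/colP => -[].
have mshift : mx_measurable (fun v => phi (v + w)).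
  move=> d T U mU; apply: mphi; apply: cmeasurable_mxD => //.
  exact: cmeasurable_mx_cst.
rewrite [LHS](@integral_cVS m (fun v => phi (v + w)) mshift (fun=> phi0 _)).
rewrite [RHS](@integral_cVS m phi mphi phi0).
pose w1 := w 0 0; pose w2 : 'cV_m := @dsubmx _ 1 m 1 w.
have wE : w = col_mx w1%:M w2 :> 'cV_(1 + m).
  rewrite -[LHS](@vsubmxK _ 1 m 1); congr col_mx.
  by rewrite [LHS]mx11_scalar !mxE lshift0.
pose g x := integral_cV (fun v : 'cV_m => phi (col_mx (complex_of_plane x)%:M v)).
rewrite -(@integral_complex_shift w1 g); last 2 first.
- exact: (@measurable_integral_cV m phi).
- by move=> x; apply: integral_ge0.
apply: eq_integral => x _; rewrite /g complex_of_plane_shift.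
rewrite -(IHm (fun v => phi (col_mx (complex_of_plane x + w1)%:M v)) w2)//.
  by apply: eq_integral => t _; rewrite wE add_col_mx -raddfD.
move=> d T U mU; apply: mphi; apply: (@cmeasurable_col_mx _ _ 1 m 1 (fun=> _) U) => //.
exact: cmeasurable_mx_cst.
Qed.

Lemma integral_cVZl m (phi : 'cV[C]_m -> \bar R) k :
  mx_measurable phi -> (forall v, 0 <= phi v)%E -> (0 <= k)%E ->
  integral_cV (fun v => k * phi v)%E = (k * integral_cV phi)%E.
Proof.
move=> mphi phi0 k0; rewrite /integral_cV ge0_integralZl//.
by apply: mphi; exact: cmeasurable_col_of_planes.
Qed.

End column_integral.

(** * Integrals of inverse powers of the determinant of a rank-one update *)

Section determinant_integral.
Local Open Scope sesquilinear_scope.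
Context {R : realType}.
Local Notation C := R[i].
Local Notation plane := (planeT R).
Local Notation lebC := (@lebesgue_C R).
Local Notation mu := (@lebesgue_measure R).

(** No information is lost on positive definite matrices, by [posdefmx_rdet]. *)
Definition rdet n (H : 'M[C]_n) : R := complex.Re (\det H).

Lemma gt0_complexE (z : C) : 0 < z -> z = (complex.Re z)%:C%C /\ 0 < complex.Re z.
Proof. by case: z => a b; rewrite ltcE/= => /andP[/eqP -> ?]. Qed.

Lemma posdefmx_rdet n (H : 'M[C]_n) : posdefmx H ->
  \det H = (rdet H)%:C%C /\ 0 < rdet H.
Proof. by move=> /posdefmx_det_gt0; exact: gt0_complexE. Qed.

Lemma Re_mulrC (a : R) (z : C) : complex.Re (a%:C%C * z) = a * complex.Re z.
Proof. by case: z => x y /=; rewrite mul0r subr0. Qed.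

Lemma sqnormc_ge0 (z : C) : 0 <= sqnormc z.
Proof. by rewrite addr_ge0// sqr_ge0. Qed.

Definition rank_one_update m (H : 'M[C]_m) (k : R) (v : 'cV[C]_m) : 'M[C]_m :=
  H + k%:C%C *: (v *m v^t*).

Lemma posdefmx_update m (H : 'M[C]_m) (k : R) (v : 'cV_m) :
  0 <= k -> posdefmx H -> posdefmx (rank_one_update H k v).
Proof.
move=> k0 [hH pH].
have kJ : ((k%:C)%C)^* = (k%:C)%C by exact: conjc_real.
split; first by rewrite conjtrD conjtrZ conjtr_mulmx trmxCK hH kJ.
move=> w w0; rewrite mulmxDr mulmxDl mxE ltr_wpDr ?pH//.
rewrite -scalemxAr -scalemxAl mxE mulr_ge0 ?ler0c//.
have -> : w *m (v *m v^t*) *m w^t* = (w *m v) *m (w *m v)^t*.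
  by rewrite conjtr_mulmx !mulmxA.
exact: mulmx_conjtr_ge0.
Qed.

Lemma rdet_update_gt0 m (H : 'M[C]_m) (k : R) (v : 'cV_m) :
  0 <= k -> posdefmx H -> 0 < rdet (rank_one_update H k v).
Proof. by move=> k0 pH; have [] := posdefmx_rdet (posdefmx_update v k0 pH). Qed.

Lemma mx_measurable_rdet_update m (H : 'M[C]_m) (k : R) p :
  mx_measurable (fun v => ((rdet (rank_one_update H k v)) ^- p)%:E).
Proof.
move=> d T U mU; apply/measurable_EFinP; apply: measurable_inv_expr.
have [] // : cmeasurable (fun x => \det (rank_one_update H k (U x))).
apply: cmeasurable_det; apply: cmeasurable_mxD; first exact: cmeasurable_mx_cst.
apply: cmeasurable_mxZ; apply: cmeasurable_mulmx => //.
exact: cmeasurable_conjtr.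
Qed.

Lemma rdet_update_col_mx m (H : 'M[C]_(1 + m)) (k : R) (x : C) (v : 'cV_m) :
  posdefmx H -> 0 <= k ->
  let h := complex.Re (H 0 0) in let a := h + k * sqnormc x in
  rdet (rank_one_update H k (col_mx x%:M v)) =
  a * rdet (rank_one_update (schur_complement H) (k * h / a)
                            (v - (x / H 0 0) *: dlsubmx H)).
Proof.
move=> pH k0 h a; have [hE h0] := gt0_complexE (posdefmx00 pH).
have a0 : 0 < a by rewrite ltr_pwDl// mulr_ge0// sqnormc_ge0.
have aE : H 0 0 + (k%:C)%C * (x * x^*) = (a%:C)%C.
  by rewrite sqnormcE hE -rmorphM -rmorphD.
rewrite /rdet /rank_one_update (det_rank_one_update pH)/= aE; last first.
  by rewrite (inj_eq (@complexI _)) gt_eqF.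
by rewrite Re_mulrC -fmorphV hE -!rmorphM.
Qed.

Lemma rdet_schur_complement m (H : 'M[C]_(1 + m)) : posdefmx H ->
  rdet H = complex.Re (H 0 0) * rdet (schur_complement H).
Proof.
move=> pH; have [hE h0] := gt0_complexE (posdefmx00 pH).
rewrite /rdet det_schur_complement; last by rewrite gt_eqF ?posdefmx00.
by rewrite hE Re_mulrC.
Qed.

Section head.
Variables (m q : nat) (K : R).
Hypothesis K0 : 0 < K.
Hypothesis KE : forall (S : 'M[C]_m) (k : R), posdefmx S -> 0 < k ->
  integral_cV (fun v => ((rdet (rank_one_update S k v)) ^- (q + m).+2)%:E) =
  (K * k ^- m * rdet S ^- (q + m).+1)%:E.

(** The factor (k h / a)^-m gives back m powers of a, so that a keeps the exponent q+2 independently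
    of m. This is the origin of the common law of the factors. *)
Lemma rescale_powers (a h k s : R) : a != 0 -> h != 0 -> k != 0 -> s != 0 ->
  a ^- (q + m).+2 * (K * (k * h / a) ^- m * s ^- (q + m).+1) =
  K * k ^- m * (h * s) ^- (q + m).+1 * h ^+ q.+1 * a ^- q.+2.
Proof.
move=> a0 h0 k0 s0; rewrite -!addSn !exprMn exprVn !exprD.
(* Powers with symbolic exponents become independent nonzero variables before [field] is called. *)
move: (expf_neq0 m a0) (expf_neq0 q.+2 a0) (expf_neq0 m h0) (expf_neq0 q.+1 h0).
move: (expf_neq0 m k0) (expf_neq0 m s0) (expf_neq0 q.+1 s0).
move: (a ^+ m) (a ^+ q.+2) (h ^+ m) (h ^+ q.+1) (k ^+ m) (s ^+ m) (s ^+ q.+1).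
by move=> u1 u2 u3 u4 u5 u6 u7 z1 z2 z3 z4 z5 z6 z7; field; rewrite z1 z2 z3 z4 z5 z6 z7.
Qed.

(** For fixed x, translation invariance removes the shift of the vector and [KE] evaluates the rest.
    Only |x|^2 survives, through a = h + k |x|^2. *)
Lemma integral_tail_update (H : 'M[C]_(1 + m)) (k : R) (x : C) :
  posdefmx H -> 0 < k ->
  let h := complex.Re (H 0 0) in
  integral_cV (fun v => ((rdet (rank_one_update H k (col_mx x%:M v))) ^- (q + m).+2)%:E) =
  (K * k ^- m * rdet H ^- (q + m).+1 * h ^+ q.+1 * (h + k * sqnormc x) ^- q.+2)%:E.
Proof.
move=> pH k0 h; have [hE h0] := gt0_complexE (posdefmx00 pH).
rewrite -/h in h0; pose S := schur_complement H; pose a := h + k * sqnormc x.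
have a0 : 0 < a by rewrite ltr_pwDl// mulr_ge0 ?sqnormc_ge0// ltW.
have pS : posdefmx S by exact: posdefmx_schur_complement.
have ka0 : 0 < k * h / a by rewrite divr_gt0// mulr_gt0.
pose phi (v : 'cV_m) : \bar R := ((rdet (rank_one_update S (k * h / a) v)) ^- (q + m).+2)%:E.
have phi0 v : (0 <= phi v)%E.
  by rewrite lee_fin invr_ge0 exprn_ge0// ltW// rdet_update_gt0// ltW.
have mphi : mx_measurable phi by exact: mx_measurable_rdet_update.
transitivity (integral_cV (fun v => (a ^- (q + m).+2)%:E * phi (v + - ((x / H 0 0) *: dlsubmx H))%R)%E).
  apply: eq_integral => t _.
  by rewrite rdet_update_col_mx ?(ltW k0)// exprMn invfM EFinM.
rewrite integral_cVZl; last 3 first.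
- by move=> d T U mU; apply: mphi; apply: cmeasurable_mxD => //; exact: cmeasurable_mx_cst.
- by move=> v; exact: phi0.
- by rewrite lee_fin invr_ge0 exprn_ge0// ltW.
rewrite integral_cV_shift// KE// -EFinM; congr EFin.
rewrite (rdet_schur_complement pH) -/h -/S -/a.
have [_ s0] := posdefmx_rdet pS.
by rewrite [LHS]rescale_powers ?gt_eqF.
Qed.

(** The hypothesis [KE] is [integral_rdet_update] in dimension m with q+1 for q. Kept abstract, it
    lets this lemma serve twice: with F = 1 as the inductive step of [integral_rdet_update], and
    with arbitrary F once that result is available. *)
Lemma integral_head_update : exists2 K' : R, 0 < K' &
  forall (H : 'M[C]_(1 + m)) (k : R) (F : measurableTypeR R -> \bar R),
  posdefmx H -> 0 < k -> measurable_fun setT F -> (forall x, 0 <= F x)%E ->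
  (\int[lebC]_x integral_cV (fun v => F (sqnormc (complex_of_plane x)) *
    (rdet (rank_one_update H k (col_mx (complex_of_plane x)%:M v)) ^- (q + m).+2)%:E) =
  (K' * k ^- m.+1 * rdet H ^- (q + m).+1)%:E *
  \int[mu]_(s in `[0%R, +oo[) (F (complex.Re (H 0 0) / k * s)%R * ((1 + s) ^- q.+2)%:E))%E.
Proof.
have [A A0 AE] := @ge0_integral_sqnorm_plane R.
exists (A * K); first exact: mulr_gt0.
move=> H k F pH k0 mF F0; have [hE h0] := gt0_complexE (posdefmx00 pH).
set h := complex.Re (H 0 0) in h0 *.
have [_ dH0] := posdefmx_rdet pH.
pose c := K * k ^- m * rdet H ^- (q + m).+1 * h ^+ q.+1.
have c0 : 0 <= c.
  by rewrite /c !mulr_ge0 ?invr_ge0 ?exprn_ge0 ?ltW.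
(* The absolute value makes [G] nonnegative on the whole line, as the radial formula requires; h + k
   r is nonnegative wherever it is evaluated. *)
pose G (r : measurableTypeR R) : \bar R := (F r * (c * `|h + k * r| ^- q.+2)%:E)%E.
have mG : measurable_fun setT G.
  apply: emeasurable_funM => //; apply/measurable_EFinP.
  apply: measurable_funM => //; apply: measurable_inv_expr.
  apply: measurableT_comp => //.
  by apply: measurable_funD => //; exact: measurable_funM.
have G0 r : (0 <= G r)%E.
  by rewrite mule_ge0// lee_fin mulr_ge0// invr_ge0 exprn_ge0.
transitivity (\int[lebC]_x G (sqnorm_plane x))%E.
  apply: eq_integral => x _; rewrite sqnormc_complex_of_plane.
  rewrite (integral_cVZl (phi := fun v => (rdet (rank_one_update H k (col_mx (complex_of_plane x)%:M v)) ^- (q + m).+2)%:E)).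
  - rewrite integral_tail_update// /G sqnormc_complex_of_plane ger0_norm//.
    by rewrite addr_ge0 ?mulr_ge0 ?sqnorm_plane_ge0// ltW.
  - move=> d T U mU; apply: mx_measurable_rdet_update.
    apply: (@cmeasurable_col_mx _ _ _ 1 m 1 (fun=> _) U) => //.
    exact: cmeasurable_mx_cst.
  - by move=> v; rewrite lee_fin invr_ge0 exprn_ge0// ltW// rdet_update_gt0// ltW.
  - exact: F0.
rewrite AE//.
(* The substitution r = (h/k) s turns h + k r into h (1 + s). *)
have hk0 : 0 < h / k by exact: divr_gt0.
have := ge0_integral_itv0y_scale hk0 mG G0.
move=> /(congr1 (mule (h / k)%:E)).
rewrite muleA -EFinM divff ?gt_eqF// mul1e => <-.
have -> : (A * K * k ^- m.+1 * rdet H ^- (q + m).+1)%:E =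
   (A%:E * ((h / k)%:E * (c / h ^+ q.+2)%:E))%E.
  rewrite -!EFinM; congr EFin; rewrite /c !exprS.
  have hn0 : h != 0 by rewrite gt_eqF.
  have kn0 : k != 0 by rewrite gt_eqF.
  have dn0 : rdet H != 0 by rewrite gt_eqF.
  by field; rewrite hn0 kn0 dn0 !expf_neq0.
rewrite -!muleA; congr (_ * (_ * _))%E.
have mFs : measurable_fun setT (fun s : measurableTypeR R => F (h / k * s)).
  by apply: (measurableT_comp mF); exact: measurable_funM.
rewrite -ge0_integralZl//; last 3 first.
- apply: measurable_funTS; apply: emeasurable_funM => //.
  apply/measurable_EFinP; apply: measurable_inv_expr.
  exact: measurable_funD.
- move=> s; rewrite /= in_itv/= andbT => s0.
  by rewrite mule_ge0// lee_fin invr_ge0 exprn_ge0// addr_ge0.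
- by rewrite lee_fin divr_ge0 ?exprn_ge0// ltW.
apply: eq_integral => s; rewrite inE/= in_itv/= andbT => s0.
rewrite /G muleCA -EFinM; congr (_ * EFin _)%E.
have -> : k * (h / k * s) = h * s by field; rewrite gt_eqF.
rewrite -[X in `|X + _|]mulr1 -mulrDr ger0_norm; last by rewrite mulr_ge0 ?addr_ge0// ltW.
by rewrite exprMn invfM mulrA.
Qed.

End head.

(** The constant is quantified before H and k, hence does not depend on the entries that H contains.
    The induction trades one dimension for one unit of q, which leaves q + m unchanged. *)
Lemma integral_rdet_update m q : exists2 K : R, 0 < K &
  forall (H : 'M[C]_m) (k : R), posdefmx H -> 0 < k ->
  integral_cV (fun v => ((rdet (rank_one_update H k v)) ^- (q + m).+1)%:E) =
  (K * k ^- m * rdet H ^- (q + m))%:E.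
Proof.
elim: m q => [|m IHm] q.
  exists 1 => // H k pH k0; rewrite integral_cV0; last exact: mx_measurable_rdet_update.
  by rewrite /rdet !det_mx00 expr0 invr1 !expr1n !invr1 !mulr1.
have [K K0 KE] := IHm q.+1.
have [K' K'0 K'E] := @integral_head_update m q K K0 KE.
exists (K' / q.+1%:R) => [|H k pH k0]; first by rewrite divr_gt0// ltr0n.
rewrite (@integral_cVS _ m (fun v => ((rdet (rank_one_update (H : 'M[C]_(1 + m)) k v)) ^- (q + m.+1).+1)%:E)); last 2 first.
- exact: mx_measurable_rdet_update.
- by move=> v; rewrite lee_fin invr_ge0 exprn_ge0// ltW// rdet_update_gt0// ltW.
have KE1 := K'E H k (fun=> 1%E) pH k0 (measurable_cst _) (fun=> lee01).
rewrite addnS; apply: (eq_trans _ (eq_trans KE1 _)).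
  by apply: eq_integral => x _; apply: eq_integral => t _; rewrite mul1e.
under eq_integral do rewrite mul1e.
rewrite integral_itv0y_inv_expr -EFinM; congr EFin.
by rewrite -!mulrA; congr (_ * _); rewrite mulrA mulrC.
Qed.

End determinant_integral.

(** * Recursion over the columns of the Schur form *)

Section column_update.
Local Open Scope sesquilinear_scope.
Context {R : realType}.
Local Notation C := R[i].
Local Notation plane := (planeT R).
Local Notation lebC := (@lebesgue_C R).
Local Notation mu := (@lebesgue_measure R).

Lemma rdet_congr n (A H : 'M[C]_n) : \det A = 1 -> rdet (A *m H *m A^t*) = rdet H.
Proof.
move=> A1; rewrite /rdet !det_mulmx A1 det_map_mx det_tr A1.
by rewrite rmorph1 mul1r mulr1.
Qed.

Lemma rank_one_update_congr n (A H : 'M[C]_n) k v :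
  A *m rank_one_update H k v *m A^t* = rank_one_update (A *m H *m A^t*) k (A *m v).
Proof.
rewrite /rank_one_update mulmxDr mulmxDl -scalemxAr -scalemxAl.
by rewrite conjtr_mulmx !mulmxA.
Qed.

(** With B unimodular of first row b, replacing H by its congruence H' under B makes b u the first
    coordinate and b H b^t* the corner of H', so that [integral_head_update] applies to H'. *)
Lemma integral_column_update m q : exists2 K : R, 0 < K &
  forall (H : 'M[C]_(1 + m)) (b' : 'rV_m) (k : R) (F : measurableTypeR R -> \bar R),
  posdefmx H -> 0 < k -> measurable_fun setT F -> (forall x, 0 <= F x)%E ->
  let b : 'rV_(1 + m) := row_mx 1%:M b' in
  (integral_cV (fun u : 'cV_(1 + m) => F (sqnormc ((b *m u) 0%R 0%R)) *
    (rdet (rank_one_update H k u) ^- (q + m).+2)%:E) =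
  (K * k ^- m.+1 * rdet H ^- (q + m).+1)%:E *
  \int[mu]_(s in `[0%R, +oo[)
    (F (complex.Re ((b *m H *m b^t*) 0%R 0%R) / k * s)%R * ((1 + s) ^- q.+2)%:E))%E.
Proof.
have [K0 K00 K0E] := @integral_rdet_update R m q.+1.
have [K K_0 KE] := integral_head_update K00 K0E.
exists K => // H b' k F pH k0 mF F0 b.
pose B : 'M[C]_(1 + m) := block_mx 1%:M b' 0 1%:M.
have BE : B = col_mx b (row_mx 0 1%:M) by rewrite /B block_mxEv.
have detB : \det B = 1 by rewrite det_ublock !det1 mulr1.
have uB : B \in unitmx by rewrite unitmxE detB unitr1.
pose H' := B *m H *m B^t*.
have pH' : posdefmx H' by exact: posdefmx_congr.
have <- : rdet H' = rdet H by exact: rdet_congr.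
have <- : H' 0 0 = (b *m H *m b^t*) 0 0.
  rewrite /H' BE mul_col_mx tr_col_mx map_row_mx mul_col_row.
  by rewrite -[in LHS](lshift0 m 0) block_mxEul.
rewrite -KE//.
pose psi (u : 'cV[C]_(1 + m)) : \bar R := (F (sqnormc (u 0%R 0%R)) *
    (rdet (rank_one_update H' k u) ^- (q + m).+2)%:E)%E.
have psi0 u : (0 <= psi u)%E.
  by rewrite mule_ge0// lee_fin invr_ge0 exprn_ge0// ltW// rdet_update_gt0// ltW.
have mpsi : mx_measurable psi.
  move=> d T U mU; apply: emeasurable_funM.
    apply: (measurableT_comp mF); apply: measurable_sqnormc; exact: mU.
  exact: mx_measurable_rdet_update.
transitivity (integral_cV (fun u => psi (B *m u))).
  apply: eq_integral => t _; set u := col_of_planes _ _.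
  rewrite /psi -rank_one_update_congr rdet_congr//; congr (F (sqnormc _) * _)%E.
  by rewrite BE mul_col_mx -[in RHS](lshift0 m 0) col_mxEu.
have mpsiB : mx_measurable (fun u => psi (B *m u)).
  by move=> d T U mU; apply: mpsi; apply: cmeasurable_mulmx => //; exact: cmeasurable_mx_cst.
apply: (eq_trans (@integral_cVS _ m (fun u => psi (B *m u)) mpsiB (fun=> psi0 _))).
(* B maps (x, v) to (x + b' v, v). Integrating over x first, with v fixed, reduces this change of
   variables to a translation of the plane. *)
apply: (eq_trans (integral_cV_swap mpsiB (fun=> psi0 _))).
transitivity (\int[lebC]_x integral_cV (fun v => psi (col_mx (complex_of_plane x)%:M v)))%E; last first.
  apply: eq_integral => x _; apply: eq_integral => t _.
  by rewrite /psi -(lshift0 m 0) col_mxEu mxE eqxx.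
apply: (eq_trans _ (esym (integral_cV_swap mpsi psi0))).
apply: eq_integral => t _; set v := col_of_planes _ _.
have mpsiv : measurable_fun setT (fun x => psi (col_mx (complex_of_plane x)%:M v)).
  apply: mpsi; apply: (@cmeasurable_col_mx _ _ _ 1 m 1 _ (fun=> v)).
    by apply: cmeasurable_scalar_mx; exact: cmeasurable_complex_of_plane.
  exact: cmeasurable_mx_cst.
apply: (eq_trans _ (integral_complex_shift ((b' *m v) 0%R 0%R) mpsiv (fun=> psi0 _))).
apply: eq_integral => x _; rewrite complex_of_plane_shift; congr psi.
rewrite /B mul_block_col !mul1mx mul0mx add0r; congr col_mx.
by rewrite raddfD/= -mx11_scalar.
Qed.

Lemma det_block_scalar_dr (F : fieldType) m (a : F) (A : 'M[F]_m) (b : 'cV[F]_m) (c : 'rV[F]_m) :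
  a != 0 -> \det (block_mx A b c a%:M) = a * \det (A - a^-1 *: (b *m c)).
Proof.
move=> a0.
have E : block_mx A b c a%:M *m block_mx 1%:M 0 (- a^-1 *: c) 1%:M =
    block_mx (A - a^-1 *: (b *m c)) b 0 a%:M.
  rewrite mulmx_block !mulmx1 !mulmx0 !add0r mul_scalar_mx scalerA mulrN mulfV// scaleN1r addrN.
  by rewrite -scalemxAr scaleNr.
move/(congr1 (@determinant _ _)) : E.
by rewrite det_mulmx det_lblock !det1 !mulr1 det_ublock det_scalar1 mulrC.
Qed.

(** * The Schur form and its left eigenvector for the first eigenvalue *)

Section triangular.
Variable l : nat -> C.
Implicit Types (z u : seq plane) (n i j : nat).

Definition entry z i j : C := complex_of_plane (nth (0 : R, 0 : R) z ('C(j, 2) + i)).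

(* For all [n], [tri_mx n z] reads the same sequence [z]: by the column-wise
   listing of the entries, it is the leading block of [tri_mx n.+1 z]. *)
Definition tri_mx n z : 'M[C]_n :=
  \matrix_(i, j) if i == j then l i else if (i < j)%N then entry z i j else 0.

(** The equation b T = l_0 b solved column by column, normalized by b_0 = 1. Each coordinate
    involves all earlier ones, so the recursion carries the whole list in order to be structural. *)
Fixpoint left_coords z n : seq C :=
  if n is m.+1 then
    let s := left_coords z m in
    rcons s (if m == 0 then 1
             else (\sum_(i < m) s`_i * entry z i m) / (l 0%N - l m))
  else [::].

Definition left_coord z n : C := (left_coords z n.+1)`_n.

Definition left_row n z : 'rV[C]_n := \row_(i < n) left_coord z i.

Lemma size_left_coords z n : size (left_coords z n) = n.
Proof. by elim: n => //= n IHn; rewrite size_rcons IHn. Qed.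

Lemma nth_left_coords z n i : (i < n)%N -> (left_coords z n)`_i = left_coord z i.
Proof.
elim: n => // n IHn; rewrite ltnS leq_eqVlt => /predU1P[->//|i_n].
by rewrite /= nth_rcons size_left_coords i_n IHn.
Qed.

Lemma left_coord0 z : left_coord z 0 = 1.
Proof. by []. Qed.

Lemma left_coordS z n : left_coord z n.+1 =
  (\sum_(i < n.+1) left_coord z i * entry z i n.+1) / (l 0%N - l n.+1).
Proof.
rewrite {1}/left_coord -[left_coords z n.+2]/(rcons (left_coords z n.+1) _).
rewrite nth_rcons size_left_coords ltnn eqxx/=; congr (_ / _).
by apply: eq_bigr => i _; rewrite -(nth_left_coords z (ltn_ord i)).
Qed.

Lemma left_row_eigen n z : (forall i j, (i < n)%N -> (j < n)%N -> l i = l j -> i = j) ->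
  left_row n z *m tri_mx n z = l 0%N *: left_row n z.
Proof.
move=> linj; apply/rowP => j; rewrite !mxE.
under eq_bigr do rewrite !mxE.
rewrite (bigD1 j)//= eqxx.
have -> : \sum_(i < n | i != j) left_coord z i *
    (if i == j then l i else if (i < j)%N then entry z i j else 0) =
    \sum_(i < j) left_coord z i * entry z i j.
  rewrite (big_ord_widen n (fun i => left_coord z i * entry z i j)); last exact: ltnW.
  rewrite big_mkcond [RHS]big_mkcond/=; apply: eq_bigr => i _.
  rewrite -(inj_eq val_inj)/=; case: ltngtP => //= _; rewrite ?mulr0//.
case: j => -[|j] jn /=.
  by rewrite big_ord0 left_coord0 addr0 mulrC.
have l0j : l 0%N - l j.+1 != 0.
  by rewrite subr_eq0; apply/eqP => /linj-/(_ (leq_ltn_trans (leq0n _) jn) jn).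
have -> : \sum_(i < j.+1) left_coord z i * entry z i j.+1 =
    left_coord z j.+1 * (l 0%N - l j.+1).
  by rewrite left_coordS divfK.
by ring.
Qed.

Section append.
Variables (n : nat) (z u : seq plane).
Hypothesis sz : size z = 'C(n, 2).

Lemma entry_cat_old i j : (i < j < n)%N -> entry (z ++ u) i j = entry z i j.
Proof.
move=> /andP[ij jn]; rewrite /entry nth_cat sz ifT//.
(* Column j occupies the positions from C(j,2) up to C(j+1,2) excluded, hence lies within [z] when j
   < n. *)
have : ('C(j.+1, 2) <= 'C(n, 2))%N by exact: leq_bin2l.
by apply: leq_trans; rewrite binS bin1 -addnS leq_add2l.
Qed.

Lemma entry_cat_new i : entry (z ++ u) i n = complex_of_plane (nth (0 : R, 0 : R) u i).
Proof. by rewrite /entry nth_cat sz ltnNge leq_addr/= addKn. Qed.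

Lemma left_coord_cat i : (i < n)%N -> left_coord (z ++ u) i = left_coord z i.
Proof.
elim/ltn_ind: i => -[|i] IHi iLn //.
rewrite !left_coordS; congr (_ / _); apply: eq_bigr => j _.
by rewrite IHi ?entry_cat_old ?ltn_ord// (ltn_trans _ iLn).
Qed.

Lemma tri_mx_cat :
  tri_mx (n + 1) (z ++ u) = block_mx (tri_mx n z) (col_of_planes n u) 0 (l n)%:M.
Proof.
apply/matrixP => i j; rewrite [LHS]mxE [RHS]mxE.
case: splitP => i' ii'; rewrite [RHS]mxE; case: splitP => j' jj'; rewrite [RHS]mxE -!(inj_eq val_inj)/= ii' jj'.
- by case: eqP => // _; case: ifP => // ij; rewrite entry_cat_old// ij ltn_ord.
- have ij : (i' < n + j')%N by rewrite ltn_addr.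
  by rewrite (ltn_eqF ij) ij ord1 addn0 entry_cat_new.
- by rewrite gtn_eqF ?ltn_addr// ltnNge ltnW ?ltn_addr.
- by rewrite !ord1 !eqxx !addn0.
Qed.

End append.

End triangular.

End column_update.

(** * Integrating out the last column, and the resulting chain *)

Section spectrum_recursion.
Local Open Scope sesquilinear_scope.
Context {R : realType}.
Local Notation C := R[i].
Local Notation plane := (planeT R).
Local Notation lebC := (@lebesgue_C R).
Local Notation mu := (@lebesgue_measure R).
Variables (l : nat -> C) (N : nat).
Hypothesis linj : forall i j, (i < N)%N -> (j < N)%N -> l i = l j -> i = j.

Lemma sqnormc_normc (z : C) : sqnormc z = Normc.normc z ^+ 2.
Proof. by case: z => a b; rewrite /sqnormc/= sqr_sqrtr// addr_ge0// sqr_ge0. Qed.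

Lemma sqnormcM (y z : C) : sqnormc (y * z) = sqnormc y * sqnormc z.
Proof. by rewrite !sqnormc_normc Normc.normcM exprMn. Qed.

Lemma sqnormcV (z : C) : sqnormc z^-1 = (sqnormc z)^-1.
Proof. by rewrite !sqnormc_normc Normc.normcV exprVn. Qed.

Lemma sqnormc_eq0 (z : C) : sqnormc z = 0 -> z = 0.
Proof.
by rewrite sqnormc_normc => /eqP; rewrite sqrf_eq0 => /eqP/Normc.eq0_normc.
Qed.

Definition left_sqnorm n z : R := \sum_(i < n) sqnormc (left_coord l z i).

Lemma left_row_sqnorm n z :
  (left_row l n z *m (left_row l n z)^t*) 0 0 = (left_sqnorm n z)%:C%C.
Proof.
rewrite mxE /left_sqnorm (raddf_sum (real_complex R)); apply: eq_bigr => i _.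
by rewrite !mxE sqnormcE.
Qed.

Definition gram_mx n z : 'M[C]_n := 1%:M + tri_mx l n z *m (tri_mx l n z)^t*.

Lemma posdefmx_gram_mx n z : posdefmx (gram_mx n z).
Proof. exact: posdefmx_gram. Qed.

Lemma left_row_gram n z : (n <= N)%N ->
  complex.Re ((left_row l n z *m gram_mx n z *m (left_row l n z)^t*) 0 0) =
  (1 + sqnormc (l 0%N)) * left_sqnorm n z.
Proof.
move=> nN; set b := left_row l n z.
have bT : b *m tri_mx l n z = l 0%N *: b.
  by apply: left_row_eigen => i j iLn jn; apply: linj; exact: leq_trans nN.
rewrite /gram_mx mulmxDr mulmx1 mulmxA bT mulmxDl -mulmxA -conjtr_mulmx bT.
rewrite conjtrZ -scalemxAl -scalemxAr scalerA sqnormcE [in LHS]mxE [X in _ + X]mxE left_row_sqnorm.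
by rewrite /= mul0r subr0; ring.
Qed.

Section append.
Variables (n : nat) (z u : seq plane).
Hypotheses (sz : size z = 'C(n, 2)).

Lemma rdet_gram_cat : rdet (gram_mx n.+1 (z ++ u)) =
  (1 + sqnormc (l n)) *
  rdet (rank_one_update (gram_mx n z) (1 + sqnormc (l n))^-1 (col_of_planes n u)).
Proof.
have a0 : 0 < 1 + sqnormc (l n) by rewrite ltr_pwDl// sqnormc_ge0.
set a := 1 + _ in a0 *.
have an0 : (a%:C)%C != 0 by rewrite (inj_eq (@complexI _)) gt_eqF.
rewrite -[n.+1]addn1 /gram_mx tri_mx_cat//.
set T := tri_mx l n z; set v := col_of_planes n u.
have -> : 1%:M + block_mx T v 0 (l n)%:M *m (block_mx T v 0 (l n)%:M)^t* =
    block_mx (1%:M + T *m T^t* + v *m v^t*) ((l n)^* *: v) (l n *: v^t*) (a%:C)%C%:M.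
  rewrite tr_block_mx map_block_mx mulmx_block trmx0 map_mx0 !mul0mx !mulmx0.
  rewrite tr_scalar_mx map_scalar_mx !add0r mul_mx_scalar mul_scalar_mx.
  rewrite (scalar_mx_block n 1 1) add_block_mx !add0r -scalar_mxM sqnormcE -raddfD/=.
  have -> : 1 + ((sqnormc (l n))%:C)%C = (a%:C)%C by apply/eqP; rewrite eq_complex/= addr0 !eqxx.
  by rewrite addrA.
rewrite /rdet det_block_scalar_dr// Re_mulrC; congr (_ * complex.Re (\det _)).
rewrite /rank_one_update -addrA; congr (_ + _).
(* The coefficient of v v^t* is 1 - |l_n|^2 / a, which equals 1/a. *)
rewrite -scalemxAl -scalemxAr !scalerA -[X in X - _]scale1r -scalerBl; congr (_ *: _).
rewrite -mulrA [_^* * _]mulrC sqnormcE -fmorphV -rmorphM -[1](rmorph1 (real_complex R)) -rmorphB/=.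
congr ((_)%:C)%C; rewrite /a.
by field; rewrite gt_eqF.
Qed.

Lemma left_sqnorm_cat : (0 < n)%N -> left_sqnorm n.+1 (z ++ u) =
  left_sqnorm n z +
  sqnormc ((left_row l n z *m col_of_planes n u) 0 0) / sqnormc (l 0%N - l n).
Proof.
case: n sz => // m szm _; rewrite /left_sqnorm big_ord_recr/=; congr (_ + _).
  by apply: eq_bigr => i _; rewrite (left_coord_cat l _ szm).
rewrite left_coordS sqnormcM sqnormcV; congr (sqnormc _ / _).
rewrite mxE; apply: eq_bigr => i _.
by rewrite !mxE (left_coord_cat l _ szm)// (entry_cat_new _ szm).
Qed.

End append.

Definition overlap_coef k : R :=
  (1 + sqnormc (l 0%N)) * (1 + sqnormc (l k)) / sqnormc (l 0%N - l k).

Lemma overlap_coef_ge0 k : 0 <= overlap_coef k.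
Proof.
apply: divr_ge0; last exact: sqnormc_ge0.
by apply: mulr_ge0; apply: addr_ge0 => //; exact: sqnormc_ge0. Qed.

(* The exponent, 2N for [n = N], is the one left on the leading block of size [n]
   when the columns [n, ..., N - 1] have been integrated out. *)
Definition overlap_mass n (f : R -> \bar R) : \bar R :=
  iterated_integral lebC 'C(n, 2)
    (fun z => f (left_sqnorm n z) * (rdet (gram_mx n z) ^- (N + n))%:E)%E.

(* One step of the multiplicative Markov chain [o => o * (1 + c_k X)]. *)
Definition factor_mean k (f : R -> \bar R) (o : R) : \bar R :=
  (\int[mu]_s (f (o * (1 + overlap_coef k * s))%R * (overlap_factor_pdf N s)%:E))%E.

Lemma overlap_factor_pdf_ge0 s : 0 <= overlap_factor_pdf N s :> R.
Proof.
rewrite /overlap_factor_pdf; case: ifP => // s0.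
by rewrite divr_ge0// exprn_ge0// addr_ge0// ltW.
Qed.

Lemma measurable_inv_expr1D (q : nat) :
  measurable_fun setT (fun s : measurableTypeR R => (1 + s) ^- q).
Proof. by apply: measurable_inv_expr; exact: measurable_funD. Qed.

Lemma overlap_factor_pdfE : (fun s => (@overlap_factor_pdf R N s)%:E) =
  ((fun s => (N.+1%:R * (1 + s) ^- N.+2)%:E) \_ `]0%R, +oo[).
Proof.
apply/funext => s; rewrite patchE /overlap_factor_pdf.
have -> : (s \in `]0%R, +oo[%classic) = (0 < s).
  by apply/idP/idP; rewrite inE/= in_itv/= andbT.
by case: ifP; rewrite // addn1 addn2.
Qed.

Lemma measurable_overlap_factor_pdf :
  measurable_fun setT (fun s : measurableTypeR R => (@overlap_factor_pdf R N s)).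
Proof.
apply/measurable_EFinP; rewrite [X in measurable_fun _ X]overlap_factor_pdfE.
apply/(measurable_restrictT _ (measurable_itv _)); apply: measurable_funTS.
apply/measurable_EFinP; apply: measurable_funM => //.
exact: measurable_inv_expr1D.
Qed.

Lemma integral_overlap_factor_pdf (g : measurableTypeR R -> \bar R) :
  measurable_fun setT g -> (forall s, 0 <= g s)%E ->
  (\int[mu]_s (g s * (overlap_factor_pdf N s)%:E) =
  N.+1%:R%:E * \int[mu]_(s in `[0%R, +oo[) (g s * ((1 + s) ^- N.+2)%:E))%E.
Proof.
move=> mg g0.
have mgp : measurable_fun setT (fun s : measurableTypeR R => g s * ((1 + s) ^- N.+2)%:E)%E.
  by apply: emeasurable_funM => //; apply/measurable_EFinP; exact: measurable_inv_expr1D.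
rewrite -integral_itv_obnd_cbnd; last exact: measurable_funTS.
rewrite -ge0_integralZl//; last 2 first.
- exact: measurable_funTS.
- move=> s; rewrite /= in_itv/= andbT => s0.
  by rewrite mule_ge0// lee_fin invr_ge0 exprn_ge0// addr_ge0// ltW.
rewrite [RHS]integral_mkcond; apply: eq_integral => s _.
have := congr1 (fun h => h s) overlap_factor_pdfE => /= ->.
by rewrite !patchE; case: ifP => _; rewrite ?mule0// EFinM muleCA.
Qed.

Lemma measurable_factor_mean k f : measurable_fun [set: measurableTypeR R] f ->
  (forall x, 0 <= f x)%E -> measurable_fun [set: measurableTypeR R] (factor_mean k f).
Proof.
move=> mf f0.
apply: (@measurable_fun_fubini_tonelli_F _ _ (measurableTypeR R) (measurableTypeR R) R mu
  (fun p => f (p.1 * (1 + overlap_coef k * p.2))%R * (overlap_factor_pdf N p.2)%:E)%E).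
  apply: emeasurable_funM.
    apply: (measurableT_comp mf); apply: measurable_funM => //.
    by apply: measurable_funD => //; apply: measurable_funM.
  apply/measurable_EFinP; apply: (measurableT_comp measurable_overlap_factor_pdf).
  exact: measurable_snd.
by move=> p; rewrite mule_ge0// lee_fin overlap_factor_pdf_ge0.
Qed.

Lemma factor_mean_ge0 k f o : (forall x, 0 <= f x)%E -> (0 <= factor_mean k f o)%E.
Proof.
by move=> f0; apply: integral_ge0 => s _; rewrite mule_ge0// lee_fin overlap_factor_pdf_ge0.
Qed.

Lemma measurable_scale_shift (o c : R) (f : measurableTypeR R -> \bar R) :
  measurable_fun setT f ->
  measurable_fun setT (fun s : measurableTypeR R => f (o * (1 + c * s))).
Proof.
move=> mf; apply: (measurableT_comp mf); apply: measurable_funM => //.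
by apply: measurable_funD => //; exact: measurable_funM.
Qed.

(** The last m+1 variables of the list are the new column, of height m+1. For fixed earlier
    variables, [integral_column_update] is applied with q = N, k = 1/a and b the left eigenvector of
    the leading block; its constant does not see these variables and so leaves the outer
    integral. *)
Lemma overlap_mass_step m : (m.+1 < N)%N -> exists2 K : R, 0 < K &
  forall f, measurable_fun [set: measurableTypeR R] f -> (forall x, 0 <= f x)%E ->
  overlap_mass m.+2 f = overlap_mass m.+1 (fun o => K%:E * factor_mean m.+1 f o)%E.
Proof.
move=> mN; have [K K0 KE] := @integral_column_update R m N.
pose a : R := 1 + sqnormc (l m.+1).
have a0 : 0 < a by rewrite ltr_pwDl// sqnormc_ge0.
have d0 : sqnormc (l 0%N - l m.+1) != 0.
  apply/eqP => /sqnormc_eq0/eqP; rewrite subr_eq0 => /eqP/linj H.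
  by have := H (leq_ltn_trans (leq0n _) mN) mN.
(* The first power of a comes from the factor a of the determinant in [rdet_gram_cat], the second is
   k^-(m+1) with k = 1/a, and 1/(N+1) compensates the normalization of the density. *)
exists (a ^- (N + m).+2 * K * a ^+ m.+1 / N.+1%:R).
  by rewrite divr_gt0 ?ltr0n// !mulr_gt0 ?invr_gt0 ?exprn_gt0.
move=> f mf f0; rewrite /overlap_mass [X in iterated_integral _ X _]binS bin1.
rewrite iterated_integral_cat; apply: eq_iterated_integral => z sz.
set o := left_sqnorm m.+1 z; pose H := gram_mx m.+1 z.
have pH : posdefmx H by exact: posdefmx_gram_mx.
have [_ dH0] := posdefmx_rdet pH.
(* The test function in terms of y = |b u|^2, by [left_sqnorm_cat]. *)
pose F (y : measurableTypeR R) := f (o + y / sqnormc (l 0%N - l m.+1)).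
have mF : measurable_fun setT F.
  apply: (measurableT_comp mf); apply: measurable_funD => //; exact: measurable_funM.
pose b' : 'rV[C]_m := @rsubmx _ 1 1 m (left_row l m.+1 z).
have bE : left_row l m.+1 z = row_mx 1%:M b' :> 'rV_(1 + m).
  rewrite -[LHS](@hsubmxK _ 1 1 m); congr row_mx.
  by rewrite [LHS]mx11_scalar !mxE lshift0.
pose b : 'rV[C]_(1 + m) := row_mx 1%:M b'.
pose phi (v : 'cV[C]_(1 + m)) : \bar R := (F (sqnormc ((b *m v) 0%R 0%R)) *
    (rdet (rank_one_update H a^-1 v) ^- (N + m).+2)%:E)%E.
have ai0 : 0 < a^-1 by rewrite invr_gt0.
have phi0 v : (0 <= phi v)%E.
  rewrite mule_ge0 ?f0// lee_fin invr_ge0 exprn_ge0// ltW//.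
  by apply: rdet_update_gt0 => //; exact: ltW.
have mphi : mx_measurable phi.
  move=> d T U mU; apply: emeasurable_funM.
    apply: (measurableT_comp mF); apply: measurable_sqnormc.
    have := cmeasurable_mulmx (cmeasurable_mx_cst _ b) mU; exact.
  exact: mx_measurable_rdet_update.
transitivity (iterated_integral lebC m.+1
    (fun u => (a ^- (N + m).+2)%:E * phi (col_of_planes m.+1 u))%E).
  apply: eq_iterated_integral => u _.
  rewrite left_sqnorm_cat// rdet_gram_cat// -/a -/o -/H !addnS exprMn invfM EFinM.
  by rewrite muleCA /phi /F /b -bE.
have mphic : mx_measurable (fun v => (a ^- (N + m).+2)%:E * phi v)%E.
  by move=> d T U mU; apply: measurable_funeM; exact: mphi.
have ap0 : 0 <= a ^- (N + m).+2 by rewrite invr_ge0 exprn_ge0// ltW.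
rewrite -ge0_integral_tuple; last 2 first.
- by apply: mphic; exact: cmeasurable_col_of_planes.
- by move=> s; rewrite mule_ge0// ?lee_fin.
rewrite -/(integral_cV (fun v => (a ^- (N + m).+2)%:E * phi v)%E) integral_cVZl// ?lee_fin//.
have -> : integral_cV phi = ((K * a^-1 ^- m.+1 * rdet H ^- (N + m).+1)%:E *
    \int[mu]_(s in `[0%R, +oo[) (F (complex.Re ((b *m H *m b^t*) 0%R 0%R) / a^-1 * s)%R *
      ((1 + s) ^- N.+2)%:E))%E
  by exact: (KE H b' a^-1 F pH ai0 mF (fun=> f0 _)).
have -> : complex.Re ((b *m H *m b^t*) 0 0) = (1 + sqnormc (l 0%N)) * o.
  by rewrite /b -bE; exact: left_row_gram (ltnW mN).
rewrite invrK.
have mG : measurable_fun setT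
    (fun s : measurableTypeR R => f (o * (1 + overlap_coef m.+1 * s))).
  exact: measurable_scale_shift.
rewrite /factor_mean (integral_overlap_factor_pdf mG)//.
(* Here (b H b^t* / k) s is (1 + |l_0|^2) o a s; dividing by |l_0 - l_{m+1}|^2 gives o times c_{m+1}
   s. *)
have FE s : F ((1 + sqnormc (l 0%N)) * o * a * s) = f (o * (1 + overlap_coef m.+1 * s)).
  by rewrite /F /overlap_coef -/a; congr f; field.
under eq_integral do rewrite FE.
set I := (\int[mu]_(s in _) _)%E.
rewrite [RHS]muleC !muleA -!EFinM; congr (_%:E * _)%E.
have an0 : a != 0 by rewrite gt_eqF.
have dn0 : rdet H != 0 by rewrite gt_eqF.
rewrite -/H addnS exprVn invrK.
move: (expf_neq0 (N + m).+2 an0) (expf_neq0 (N + m).+1 dn0).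
move: (a ^+ (N + m).+2) (rdet H ^+ (N + m).+1) (a ^+ m.+1) => x y w x0 y0.
have : N.+1%:R != 0 :> R by rewrite pnatr_eq0.
by move: (N.+1%:R : R) => v v0; field; rewrite x0 y0 v0.
Qed.

(** The mean of f over the product of the factors 1 + c_k X_k for k = 1, ..., m with independent
    X_k. The chain starts at 1, and the factor of largest index is integrated first, in the order in
    which the columns are removed. *)
Fixpoint overlap_mean m (f : R -> \bar R) : \bar R :=
  if m is m'.+1 then overlap_mean m' (factor_mean m f) else f 1.

Lemma factor_meanZ k f c o : measurable_fun [set: measurableTypeR R] f ->
  (forall x, 0 <= f x)%E -> (0 <= c)%E ->
  factor_mean k (fun x => c * f x)%E o = (c * factor_mean k f o)%E.
Proof.
move=> mf f0 c0; rewrite /factor_mean -ge0_integralZl//.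
- by apply: eq_integral => s _; rewrite muleA.
- apply: emeasurable_funM; first exact: measurable_scale_shift.
  by apply/measurable_EFinP; exact: measurable_overlap_factor_pdf.
- by move=> s _; rewrite mule_ge0// lee_fin overlap_factor_pdf_ge0.
Qed.

Lemma overlap_meanZ m f c : measurable_fun [set: measurableTypeR R] f ->
  (forall x, 0 <= f x)%E -> (0 <= c)%E ->
  overlap_mean m (fun x => c * f x)%E = (c * overlap_mean m f)%E.
Proof.
elim: m f => //= m IHm f mf f0 c0.
have -> : factor_mean m.+1 (fun x => c * f x)%E = (fun o => c * factor_mean m.+1 f o)%E.
  by apply/funext => o; exact: factor_meanZ.
by rewrite IHm//; [exact: measurable_factor_mean|move=> o; exact: factor_mean_ge0].
Qed.

(** Iterates [overlap_mass_step] down to the block of size 1, which has no variable and squared norm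
    1. The constants are pulled out by [overlap_meanZ]. *)
Lemma overlap_massE m : (m < N)%N -> exists2 K : R, 0 < K &
  forall f, measurable_fun [set: measurableTypeR R] f -> (forall x, 0 <= f x)%E ->
  overlap_mass m.+1 f = (K%:E * overlap_mean m f)%E.
Proof.
elim: m => [_|m IHm mN].
  exists (rdet (gram_mx 1 [::]) ^- (N + 1)).
    by rewrite invr_gt0 exprn_gt0//; have [] := posdefmx_rdet (posdefmx_gram_mx 1 [::]).
  move=> f mf f0; rewrite /overlap_mass/= /left_sqnorm big_ord1 left_coord0 muleC.
  by rewrite /sqnormc/= expr1n expr0n addr0.
have [K1 K10 K1E] := IHm (ltnW mN).
have [K K0 KE] := overlap_mass_step mN.
exists (K1 * K); first exact: mulr_gt0.
move=> f mf f0; rewrite KE// K1E; last 2 first.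
- by apply: measurable_funeM; exact: measurable_factor_mean.
- by move=> o; rewrite mule_ge0 ?lee_fin ?(ltW K0)// factor_mean_ge0.
rewrite overlap_meanZ ?lee_fin ?(ltW K0)//; last 2 first.
- exact: measurable_factor_mean.
- by move=> o; exact: factor_mean_ge0.
by rewrite EFinM muleA.
Qed.

End spectrum_recursion.

(** * Product of independent factors *)

Section product_law.
Local Open Scope ereal_scope.
Context {R : realType}.
Local Notation mu := (@lebesgue_measure R).
Variables (l : nat -> R[i]) (N : nat).

(** First moments are taken of |x| because the test functions of the recursion must be nonnegative
    on the whole line. The factor 1/N is the mean of X. *)
Lemma factor_mean_norm k o : (0 < N)%N ->
  factor_mean l N k (fun x => `|x|%:E) o = (`|o| * (1 + overlap_coef l k / N%:R))%:E.
Proof.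
move=> N0; have c0 := overlap_coef_ge0 l k; set c := overlap_coef l k in c0 *.
have mnorm : measurable_fun [set: measurableTypeR R] (fun x => `|x|%:E).
  by apply/measurable_EFinP; exact: normr_measurable.
rewrite /factor_mean integral_overlap_factor_pdf; last 2 first.
- exact: (measurable_scale_shift o c mnorm).
- by move=> s; rewrite lee_fin.
have mp q : measurable_fun setT (fun s : measurableTypeR R => ((1 + s) ^- q)%:E).
  by apply/measurable_EFinP; exact: measurable_inv_expr1D.
have p0 (s : R) q : (0 <= s -> 0 <= (1 + s) ^- q)%R.
  by move=> s0; rewrite invr_ge0 exprn_ge0// addr_ge0.
have J1 : \int[mu]_(s in `[0%R, +oo[) ((1 + s) ^- N.+2)%:E = (N.+1%:R^-1)%:E.
  exact: integral_itv0y_inv_expr.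
have mspow : measurable_fun setT (fun s : measurableTypeR R => (s * (1 + s) ^- N.+2)%:E).
  apply/measurable_EFinP; apply: measurable_funM => //; exact: measurable_inv_expr1D.
(* Writes s (1+s)^-(N+2) as a difference of two inverse powers, which gives the mean (N+1)(1/N -
   1/(N+1)) = 1/N. *)
have split_pow (s : R) : (0 <= s -> (1 + s) ^- N.+1 = s * (1 + s) ^- N.+2 + (1 + s) ^- N.+2)%R.
  move=> s0; have s1 : (1 + s != 0)%R by rewrite gt_eqF// ltr_pwDl.
  have sN : ((1 + s) ^+ N != 0)%R by rewrite expf_neq0.
  by rewrite !exprS; field; rewrite s1 sN.
have J2 : \int[mu]_(s in `[0%R, +oo[) (s * (1 + s) ^- N.+2)%:E =
    (N%:R^-1 - N.+1%:R^-1)%:E.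
  have : \int[mu]_(s in `[0%R, +oo[) ((1 + s) ^- N.+1)%:E = (N%:R^-1)%:E.
    by rewrite -(prednK N0); exact: integral_itv0y_inv_expr.
  have -> : \int[mu]_(s in `[0%R, +oo[) ((1 + s) ^- N.+1)%:E =
      \int[mu]_(s in `[0%R, +oo[) ((s * (1 + s) ^- N.+2)%:E + ((1 + s) ^- N.+2)%:E).
    apply: eq_integral => s; rewrite inE/= in_itv/= andbT => s0.
    by rewrite (split_pow _ s0).
  rewrite ge0_integralD//=; last 4 first.
  - by move=> s; rewrite in_itv/= andbT => s0; rewrite lee_fin mulr_ge0// p0.
  - exact: measurable_funTS.
  - by move=> s; rewrite in_itv/= andbT => s0; rewrite lee_fin p0.
  - exact: measurable_funTS.
  rewrite J1 => H.
  by rewrite EFinB -H addeK.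
have -> : \int[mu]_(s in `[0%R, +oo[) (`|o * (1 + c * s)|%:E * ((1 + s) ^- N.+2)%:E) =
    `|o|%:E * \int[mu]_(s in `[0%R, +oo[)
       (((1 + s) ^- N.+2)%:E + c%:E * (s * (1 + s) ^- N.+2)%:E).
  rewrite -ge0_integralZl//; last 2 first.
  - apply: emeasurable_funD; first exact: measurable_funTS.
    by apply: measurable_funTS; exact: measurable_funeM.
  - move=> s; rewrite /= in_itv/= andbT => s0.
    by rewrite adde_ge0// ?mule_ge0// lee_fin ?mulr_ge0// p0.
  apply: eq_integral => s; rewrite inE/= in_itv/= andbT => s0.
  rewrite normrM [X in (_ * X)%R]ger0_norm; last by rewrite addr_ge0// mulr_ge0.
  rewrite -[RHS]/((`|o| * ((1 + s) ^- N.+2 + c * (s * (1 + s) ^- N.+2)))%:E).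
  by rewrite -EFinM; congr EFin; ring.
rewrite ge0_integralD//=; last 4 first.
- by move=> s; rewrite in_itv/= andbT => s0; rewrite lee_fin p0.
- exact: measurable_funTS.
- by move=> s; rewrite in_itv/= andbT => s0; rewrite mule_ge0// lee_fin mulr_ge0// p0.
- by apply: measurable_funTS; exact: measurable_funeM.
rewrite ge0_integralZl//=; last 2 first.
- exact: measurable_funTS.
- by move=> s; rewrite in_itv/= andbT => s0; rewrite lee_fin mulr_ge0// p0.
rewrite J1 J2 -[LHS]/((N.+1%:R * (`|o| * (N.+1%:R^-1 + c * (N%:R^-1 - N.+1%:R^-1))))%:E).
congr EFin.
have n0 : (N%:R != 0 :> R)%R by rewrite pnatr_eq0 -lt0n.
have n1 : (N%:R + 1 != 0 :> R)%R by rewrite natr1 pnatr_eq0.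
by rewrite -natr1; field; rewrite n0 n1.
Qed.

Lemma overlap_mean_norm m : (0 < N)%N ->
  overlap_mean l N m (fun x => `|x|%:E) =
  (\prod_(k < m) (1 + overlap_coef l k.+1 / N%:R))%:E.
Proof.
move=> N0; elim: m => [|m IHm]; first by rewrite big_ord0/= normr1.
have mnorm : measurable_fun [set: measurableTypeR R] (fun x => `|x|%:E).
  by apply/measurable_EFinP; exact: normr_measurable.
rewrite big_ord_recr/=.
have -> : factor_mean l N m.+1 (fun x => `|x|%:E) =
    (fun o => (1 + overlap_coef l m.+1 / N%:R)%:E * `|o|%:E).
  by apply/funext => o; rewrite factor_mean_norm// -EFinM mulrC.
rewrite overlap_meanZ//; last by rewrite lee_fin addr_ge0// divr_ge0// overlap_coef_ge0.
by rewrite IHm -EFinM mulrC.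
Qed.

Section independent_factors.
Context d (T : measurableType d) (P : probability T R).
Variables (M : nat) (X : nat -> T -> measurableTypeR R).
Hypothesis mX : forall k, measurable_fun setT (X k).
Hypothesis indX : forall B : nat -> set (measurableTypeR R), (forall k, measurable (B k)) ->
  P (\big[setI/setT]_(0 <= k < M) (X k @^-1` B k)) =
  \prod_(0 <= k < M) P (X k @^-1` B k).
Hypothesis densX : forall k (B : set (measurableTypeR R)), (k < M)%N -> measurable B ->
  P (X k @^-1` B) = \int[mu]_(x in B) (overlap_factor_pdf N x)%:E.

(** Index 0 of [l] is the eigenvalue whose overlap is studied, whence the shift between [X k] and
    [overlap_coef l k.+1]. *)
Definition partial_prod n (w : T) : measurableTypeR R :=
  (\prod_(k < n) (1 + overlap_coef l k.+1 * X k w))%R.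

Lemma measurable_partial_prod n : measurable_fun setT (partial_prod n).
Proof.
elim: n => [|n IHn].
  by rewrite /partial_prod; under eq_fun do rewrite big_ord0; exact: measurable_cst.
rewrite /partial_prod; under eq_fun do rewrite big_ord_recr/=.
apply: measurable_funM => //; apply: measurable_funD => //.
exact: (measurable_funM (measurable_cst _) (mX n)).
Qed.

Let rv n : {mfun T >-> measurableTypeR R} :=
  HB.pack (partial_prod n) (isMeasurableFun.Build _ _ _ _ _ (measurable_partial_prod n)).
Let rvX n : {mfun T >-> measurableTypeR R} :=
  HB.pack (X n) (isMeasurableFun.Build _ _ _ _ _ (mX n)).
Let law n : probability (measurableTypeR R) R := distribution P (rv n).
Let lawX n : probability (measurableTypeR R) R := distribution P (rvX n).

Let tail n (B : nat -> set (measurableTypeR R)) : set T :=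
  \big[setI/setT]_(n <= k < M) (X k @^-1` B k).

Let measurable_preimage k B : measurable B -> measurable (X k @^-1` B).
Proof. by move=> mB; rewrite -[X in measurable X]setTI; exact: mX. Qed.

Let measurable_tail n B : (forall k, measurable (B k)) -> measurable (tail n B).
Proof.
move=> mB; rewrite /tail; elim/big_ind : _ => //.
  by move=> ? ? ? ?; exact: measurableI.
by move=> k _; exact: measurable_preimage.
Qed.

Let pair n (w : T) := (partial_prod n w, X n w).

Let measurable_pair n : measurable_fun setT (pair n).
Proof.
by apply/measurable_fun_pair => //; exact: measurable_partial_prod.
Qed.

(** Independence of the first n factors' product from all later variables. Keeping the whole tail in
    the statement is what lets it pass from n to n+1. *)
Let product_tail n := forall A B, measurable A -> (forall k, measurable (B k)) ->
  P (partial_prod n @^-1` A `&` tail n B) =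
  P (partial_prod n @^-1` A) * \prod_(n <= k < M) P (X k @^-1` B k).

Let tailE n B : (n < M)%N -> tail n B = X n @^-1` B n `&` tail n.+1 B.
Proof. by move=> nM; rewrite /tail big_ltn. Qed.

(** On rectangles this is [product_tail] at n. The extension to all S uses uniqueness of the product
    measure, after dividing by the probability of the remaining tail. *)
Lemma pair_law_tail n B S : (n < M)%N -> product_tail n ->
  (forall k, measurable (B k)) -> measurable S ->
  P (pair n @^-1` S `&` tail n.+1 B) =
  (law n \x lawX n) S * \prod_(n.+1 <= k < M) P (X k @^-1` B k).
Proof.
move=> nM ptn mB mS; set e := \prod_(n.+1 <= k < M) _.
have rectE (A C : set (measurableTypeR R)) : measurable A -> measurable C ->
    P (pair n @^-1` (A `*` C) `&` tail n.+1 B) =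
    P (partial_prod n @^-1` A) * P (X n @^-1` C) * e.
  (* Inserting C at position n makes the event on X n part of the tail. *)
  move=> mA mC; pose B' k := if k == n then C else B k.
  have mB' k : measurable (B' k) by rewrite /B'; case: eqP.
  have B'n : \big[setI/setT]_(n.+1 <= k < M) (X k @^-1` B' k) = tail n.+1 B.
    by apply: eq_big_nat => k /andP[nk _]; rewrite /B' gtn_eqF.
  have tailB' : tail n.+1 B' = tail n.+1 B by exact: B'n.
  have prodB' : \prod_(n.+1 <= k < M) P (X k @^-1` B' k) = e.
    by apply: eq_big_nat => k /andP[nk _]; rewrite /B' gtn_eqF.
  have := ptn A B' mA mB'; rewrite tailE// tailB' big_ltn// prodB'.
  by rewrite /B' eqxx setIA muleA => <-.
have mtB : measurable (tail n.+1 B) by exact: measurable_tail.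
have eE : P (tail n.+1 B) = e.
  have := rectE setT setT measurableT measurableT.
  by rewrite setXTT !preimage_setT setTI probability_setT !mul1e.
have mpS : measurable (pair n @^-1` S).
  by rewrite -[X in measurable X]setTI; exact: measurable_pair.
have [r rE] : exists r : R, e = r%:E.
  by exists (fine e); rewrite fineK// -eE fin_num_measure.
(* A tail event of probability zero cannot be divided out; both sides then vanish. *)
have [r0|r0] := eqVneq r 0%R.
  rewrite rE r0 mule0; apply/eqP; rewrite eq_le measure_ge0 andbT.
  rewrite -[leRHS]/(0%R%:E) -r0 -rE -eE; apply: le_measure; rewrite ?inE//.
  exact: measurableI.
have rge0 : (0 <= r)%R by rewrite -lee_fin -rE -eE measure_ge0.
have ri0 : (0 <= r^-1)%R by rewrite invr_ge0.
pose m' := mscale (NngNum ri0) (pushforward_measure (mrestr P mtB) (measurable_pair n)).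
have -> : (law n \x lawX n) S = m' S.
  apply: product_measure_unique => // A C mA mC.
  transitivity (r^-1%:E * P (pair n @^-1` (A `*` C) `&` tail n.+1 B)); first by [].
  rewrite rectE// rE muleC -!muleA -EFinM mulfV// mule1//.
have -> : m' S = r^-1%:E * P (pair n @^-1` S `&` tail n.+1 B) by [].
by rewrite rE muleAC -EFinM mulVf// mul1e.
Qed.

Let next n (p : measurableTypeR R * measurableTypeR R) : measurableTypeR R :=
  (p.1 * (1 + overlap_coef l n.+1 * p.2))%R.

Let measurable_next n : measurable_fun setT (next n).
Proof.
by apply: measurable_funM => //; apply: measurable_funD => //; apply: measurable_funM.
Qed.

Let partial_prodS n w : partial_prod n.+1 w = next n (pair n w).
Proof. by rewrite /partial_prod big_ord_recr. Qed.

Let pair_law n S : (n < M)%N -> product_tail n -> measurable S ->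
  P (pair n @^-1` S) = (law n \x lawX n) S.
Proof.
move=> nM ptn mS.
have := @pair_law_tail n (fun=> setT) S nM ptn (fun=> measurableT) mS.
rewrite [X in _ = _ * X]big1 => [|k _]; last by rewrite preimage_setT probability_setT.
rewrite mule1 => <-; rewrite /tail big1 ?setIT//.
Qed.

Let product_tailT n : (n <= M)%N -> product_tail n.
Proof.
elim: n => [_|n IHn nM] A B mA mB.
  have [A1|A1] := pselect (A 1%R).
    have -> : partial_prod 0 @^-1` A = setT.
      by apply/seteqP; split => // w _; rewrite /= /partial_prod big_ord0.
    by rewrite setTI probability_setT mul1e; exact: indX.
  have -> : partial_prod 0 @^-1` A = set0.
    by apply/seteqP; split => // w; rewrite /= /partial_prod big_ord0.
  by rewrite set0I measure0 mul0e.
have ptn := IHn (ltnW nM).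
(* The next partial product is a function of the pair, whose joint behaviour with the tail is given
   by [pair_law_tail]. *)
have -> : partial_prod n.+1 @^-1` A = pair n @^-1` (next n @^-1` A).
  by apply/seteqP; split => w /=; rewrite partial_prodS.
have mS : measurable (next n @^-1` A).
  by rewrite -[X in measurable X]setTI; exact: measurable_next.
by rewrite pair_law_tail// pair_law.
Qed.

(** By independence of [partial_prod n] and [X n], Fubini integrates the last factor first, which is
    [factor_mean]. With [overlap_massE], both laws of the theorem are thus described by
    [overlap_mean]. *)
Lemma integral_partial_prod n f : (n <= M)%N ->
  measurable_fun [set: measurableTypeR R] f -> (forall x, 0 <= f x) ->
  \int[P]_w f (partial_prod n w) = overlap_mean l N n f.
Proof.
elim: n f => [|n IHn] f nM mf f0.
  under eq_integral do rewrite /partial_prod big_ord0.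
  have -> : \int[P]__ f 1%R = f 1%R * P setT by exact: integral_cst.
  by rewrite probability_setT mule1.
have ptn := product_tailT (ltnW nM).
rewrite /= -IHn//; last 3 first.
- exact: ltnW.
- exact: measurable_factor_mean.
- by move=> x; exact: factor_mean_ge0.
have mfn : measurable_fun setT (f \o next n) by exact: measurableT_comp.
transitivity (\int[pushforward_measure P (measurable_pair n)]_p (f \o next n) p).
  rewrite ge0_integral_pushforward//; first by apply: eq_integral => w _; rewrite partial_prodS.
  by move=> p _; exact: f0.
transitivity (\int[law n \x lawX n]_p (f \o next n) p).
  by apply: eq_measure_integral => S mS _; exact: pair_law.
rewrite (fubini_tonelli1 (f \o next n) mfn (fun=> f0 _)).
have mfm := measurable_factor_mean l N n.+1 mf f0.
transitivity (\int[law n]_y factor_mean l N n.+1 f y).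
  apply: eq_integral => y _.
  rewrite /fubini_F (@ge0_integral_density _ _ _ mu (lawX n) (overlap_factor_pdf N))//.
  - exact: measurable_overlap_factor_pdf.
  - exact: overlap_factor_pdf_ge0.
  - by move=> B mB; exact: densX.
  - exact: measurable_scale_shift.
  - by move=> x; exact: f0.
rewrite (ge0_integral_distribution (rv n) mfm)// => y.
exact: factor_mean_ge0.
Qed.

End independent_factors.
End product_law.

(** * Overlaps of triangular matrices *)

Section overlap_of_triangular.
Local Open Scope sesquilinear_scope.

(** Eigenspaces of distinct eigenvalues form a direct sum. A vanishing combination of the chosen
    eigenvectors is a decomposition of 0 in it, so each term is zero by uniqueness. *)
Lemma eigenbasis_distinct (F : fieldType) n (T : 'M[F]_n) (lam : 'I_n -> F) :
  injective lam -> (forall j, eigenvalue T (lam j)) ->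
  exists2 P : 'M[F]_n, P \in unitmx & forall j, row j P *m T = lam j *: row j P.
Proof.
move=> laminj eT.
have /fin_all_exists2[v vT v0] : forall j, exists2 v : 'rV[F]_n, v *m T = lam j *: v & v != 0.
  by move=> j; exact/eigenvalueP.
pose P := \matrix_(j < n) v j.
exists P => [|j]; last by rewrite rowK vT.
rewrite -row_free_unit; apply: inj_row_free => u uP.
have dx : mxdirect (\sum_(j < n) eigenspace T (lam j)).
  by apply: mxdirect_sum_eigenspace => j k _ _; exact: laminj.
case: (sub_dsumsmx dx (sub0mx 1 _)) => w _ _ uniqw.
have w0 j : 0 = w j by apply: (uniqw (fun=> 0)) => // [k _|]; rewrite ?sub0mx// big1.
apply/rowP => j; rewrite mxE; apply/eqP.
have : u 0 j *: v j = w j.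
  apply: (uniqw (fun j => u 0 j *: v j)) => // [k _|].
    by rewrite scalemx_sub//; apply/eigenspaceP.
  by rewrite -[LHS]uP mulmx_sum_row; apply: eq_bigr => k _; rewrite rowK.
by rewrite -w0 => /eqP; rewrite scaler_eq0 (negPf (v0 j)) orbF.
Qed.

Lemma eigenvalue_triangular (F : fieldType) n (T : 'M[F]_n) :
  (forall i j : 'I_n, (j < i)%N -> T i j = 0) -> forall j, eigenvalue T (T j j).
Proof.
move=> trT j; apply/eigenvalueP.
have /eqP/det0P[v v0 vT] : \det (T - (T j j)%:M) = 0.
  (* Transposed because [is_trig_mx] means lower triangular; the shifted matrix has a zero at
     diagonal position j. *)
  rewrite -det_tr det_trig; last first.
    apply/is_trig_mxP => i k ik; rewrite !mxE (trT _ _ ik).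
    by rewrite -(inj_eq val_inj)/= gtn_eqF// subrr.
  by rewrite (bigD1 j)//= !mxE eqxx subrr mul0r.
exists v => //; apply/eqP; rewrite -subr_eq0 -mul_mx_scalar -mulmxBr vT//.
Qed.

Context {R : realType} {N : nat}.
Local Notation C := R[i].

Lemma eigenvectors_sum (G : 'M[C]_N) lam Rv Lv : eigenvectors G lam Rv Lv ->
  \sum_j Rv j *m Lv j = 1%:M.
Proof.
move=> [_ _ LR].
pose L := \matrix_(j < N) Lv j; pose Q : 'M[C]_N := (\matrix_(j < N) (Rv j)^T)^T.
have LQ : L *m Q = 1%:M.
  apply/matrixP => i j; have := congr1 (fun M : 'M[C]_1 => M 0 0) (LR i j).
  rewrite !mxE mulr1n => <-; apply: eq_bigr => k _.
  by rewrite !mxE.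
rewrite -(mulmx1C LQ); apply/matrixP => i j; rewrite summxE mxE.
by apply: eq_bigr => k _; rewrite !mxE big_ord1.
Qed.

Lemma eigenvectors_orth_left (G : 'M[C]_N) lam Rv Lv i j (l : 'rV_N) : injective lam ->
  eigenvectors G lam Rv Lv -> l *m G = lam i *: l -> j != i -> l *m Rv j = 0.
Proof.
move=> laminj [GR _ _] lG ji.
have : (lam j - lam i) *: (l *m Rv j) = 0.
  by rewrite scalerBl scalemxAr -GR mulmxA lG scalemxAl subrr.
move/eqP; rewrite scaler_eq0 subr_eq0 (inj_eq laminj) (negPf ji) => /eqP.
exact.
Qed.

Lemma eigenvectors_orth_right (G : 'M[C]_N) lam Rv Lv i j (r : 'cV_N) : injective lam ->
  eigenvectors G lam Rv Lv -> G *m r = lam i *: r -> j != i -> Lv j *m r = 0.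
Proof.
move=> laminj [_ GL _] Gr ji.
have : (lam j - lam i) *: (Lv j *m r) = 0.
  by rewrite scalerBl scalemxAl -GL -mulmxA Gr scalemxAr subrr.
move/eqP; rewrite scaler_eq0 subr_eq0 (inj_eq laminj) (negPf ji) => /eqP.
exact.
Qed.

(** Reduces the overlap to a single normalized pair. The pair can replace the i-th one of any
    biorthogonal family, which gives existence. For any other family, simplicity of the spectrum
    gives l = a L_i and r = b R_i with a b = 1, so the scalars cancel in the overlap. *)
Lemma overlap_diagE (G : 'M[C]_N) lam i (l : 'rV_N) (r : 'cV_N) : injective lam ->
  (exists Rv Lv, eigenvectors G lam Rv Lv) ->
  l *m G = lam i *: l -> G *m r = lam i *: r -> l *m r = 1%:M ->
  overlap G lam i i = ((l *m l^t*) *m (r^t* *m r)) 0 0.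
Proof.
move=> laminj [R0 [L0 E0]] lG Gr lr.
rewrite /overlap; apply: xget_unique => /=.
  exists (fun j => if j == i then r else R0 j), (fun j => if j == i then l else L0 j).
  rewrite eqxx; split; last exact: mx11_scalar.
  have [GR GL LR] := E0.
  split=> [j|j|j k]; first by case: eqP => [->|].
    by case: eqP => [->|].
  case: (eqVneq j i) => [ji|ji]; case: (eqVneq k i) => [ki|ki].
  - by rewrite ji ki eqxx.
  - by rewrite (eigenvectors_orth_left laminj E0 lG ki) ji eq_sym (negPf ki) raddf0.
  - by rewrite (eigenvectors_orth_right laminj E0 Gr ji) ki (negPf ji) raddf0.
  - exact: LR.
move=> o [Rv [Lv [E oE]]].
have lE : l = (l *m Rv i) 0 0 *: Lv i.
  rewrite -[LHS]mulmx1 -(eigenvectors_sum E) mulmx_sumr (bigD1 i)//= big1 => [|j ji].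
    by rewrite addr0 mulmxA -mul_scalar_mx -mx11_scalar.
  by rewrite mulmxA (eigenvectors_orth_left laminj E lG ji) mul0mx.
have rE : r = (Lv i *m r) 0 0 *: Rv i.
  rewrite -[LHS]mul1mx -(eigenvectors_sum E) mulmx_suml (bigD1 i)//= big1 => [|j ji].
    by rewrite addr0 -mulmxA -mul_mx_scalar -mx11_scalar.
  by rewrite -mulmxA (eigenvectors_orth_right laminj E Gr ji) mulmx0.
move: lE rE; set a := _ 0 0; set b := _ 0 0 => lE rE.
have ab : a * b = 1.
  have [_ _ /(_ i i)] := E; rewrite eqxx => LRi.
  move: lr; rewrite lE rE -scalemxAl -scalemxAr LRi scalerA => /matrixP/(_ 0 0).
  by rewrite !mxE mulr1.
have -> : o = ((Lv i *m (Lv i)^t*) *m ((Rv i)^t* *m Rv i)) 0 0.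
  by rewrite oE mxE eqxx.
rewrite lE rE !conjtrZ -!scalemxAl -!scalemxAr !scalerA [RHS]mxE.
rewrite -scalemxAl [X in _ * X]mxE; set Z := (_ *m _) 0 0.
have abJ : a^* * b^* = 1 by rewrite -rmorphM ab rmorph1.
have -> : a * (b^* * b) * (a^* * Z) = (a * b) * (a^* * b^*) * Z by ring.
by rewrite ab abJ !mul1r.
Qed.

Lemma unitarymxK (U : 'M[C]_N) : U \is unitarymx -> U^t* *m U = 1%:M.
Proof. by move=> /unitarymxP /mulmx1C. Qed.

Lemma eigenvectors_unitary_conj (T U : 'M[C]_N) lam : U \is unitarymx ->
  (exists Rv Lv, eigenvectors T lam Rv Lv) ->
  exists Rv Lv, eigenvectors (U *m T *m U^t*) lam Rv Lv.
Proof.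
move=> uU [Rv [Lv [TR TL LR]]]; have UU := unitarymxK uU.
exists (fun j => U *m Rv j), (fun j => Lv j *m U^t*); split=> [j|j|j k].
- by rewrite -!mulmxA (mulmxA _ U) UU mul1mx TR scalemxAr.
- by rewrite !mulmxA -(mulmxA _ _ U) UU mulmx1 TL scalemxAl.
- by rewrite -mulmxA (mulmxA _ U) UU mul1mx.
Qed.

Lemma eigenvectors_triangular (T : 'M[C]_N) lam : injective lam ->
  (forall i j : 'I_N, (j < i)%N -> T i j = 0) -> (forall i, T i i = lam i) ->
  exists Rv Lv, eigenvectors T lam Rv Lv.
Proof.
move=> laminj trT dT.
have [P uP PT] : exists2 P : 'M[C]_N, P \in unitmx & forall j, row j P *m T = lam j *: row j P.
  by apply: eigenbasis_distinct => // j; rewrite -dT; exact: eigenvalue_triangular.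
have PTd : P *m T = diag_mx (\row_j lam j) *m P.
  apply/row_matrixP => j; rewrite row_mul PT; apply/rowP => k.
  by rewrite mul_diag_mx !mxE.
have TP : T *m invmx P = invmx P *m diag_mx (\row_j lam j).
  by rewrite -[LHS]mul1mx -(mulVmx uP) -!mulmxA (mulmxA P) PTd mulmxK.
exists (fun j => col j (invmx P)), (fun j => row j P); split=> [j|j|j k].
- rewrite [in LHS]colE mulmxA TP -colE; apply/colP => k.
  by rewrite mxE mul_mx_diag !mxE mulrC.
- exact: PT.
- apply/matrixP => p q; rewrite !ord1 -row_mul.
  have := congr1 (fun M : 'M[C]_N => M j k) (mulmxV uP).
  by rewrite /= !mxE mulr1n => <-; apply: eq_bigr => s _; rewrite !mxE.
Qed.

Lemma diag_overlap_triangular (T U : 'M[C]_N) lam i (b : 'rV_N) : injective lam ->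
  U \is unitarymx ->
  (forall i j : 'I_N, (j < i)%N -> T i j = 0) -> (forall i, T i i = lam i) ->
  nat_of_ord i = 0%N -> b *m T = lam i *: b -> b 0 i = 1 ->
  diag_overlap (U *m T *m U^t*) lam i = complex.Re ((b *m b^t*) 0 0).
Proof.
move=> laminj uU trT dT i0 bT bi; have UU := unitarymxK uU.
pose e : 'cV[C]_N := delta_mx i 0.
have Te : T *m e = lam i *: e.
  rewrite -colE; apply/colP => k; rewrite !mxE eqxx andbT.
  have [->|ki] := eqVneq k i; first by rewrite dT mulr1.
  by rewrite trT ?mulr0// i0 lt0n -i0 (inj_eq val_inj).
rewrite /diag_overlap (@overlap_diagE _ _ _ (b *m U^t*) (U *m e))//.
- have -> : (b *m U^t*) *m (b *m U^t*)^t* = b *m b^t*.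
    by rewrite conjtr_mulmx trmxCK -!mulmxA (mulmxA _ U) UU mul1mx.
  have -> : (U *m e)^t* *m (U *m e) = 1%:M.
    rewrite conjtr_mulmx -!mulmxA (mulmxA _ U) UU mul1mx.
    rewrite /e trmx_delta map_delta_mx mul_delta_mx.
    by apply/matrixP => p q; rewrite !ord1 !mxE !eqxx.
  by rewrite mulmx1.
- exact/eigenvectors_unitary_conj/eigenvectors_triangular.
- by rewrite !mulmxA -(mulmxA _ _ U) UU mulmx1 bT scalemxAl.
- by rewrite -!mulmxA (mulmxA _ U) UU mul1mx Te scalemxAr.
- rewrite -mulmxA (mulmxA _ U) UU mul1mx -colE.
  by apply/matrixP => p q; rewrite !ord1 !mxE bi.
Qed.

End overlap_of_triangular.

(** * Conditional law of the overlap *)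

Lemma mnormalizeE (R : realType) d (T : measurableType d)
    (m : {measure set T -> \bar R}) (P : probability T R) (K : R) (A : set T) :
  m setT = K%:E -> 0 < K -> mnormalize m P A = (m A * K^-1%:E)%E.
Proof. by move=> mK K0; rewrite /mnormalize mK eqe gt_eqF. Qed.

Section conditional_law.
Local Open Scope sesquilinear_scope.
Context {R : realType}.
Local Notation C := R[i].
Local Notation plane := (planeT R).
Local Notation lebC := (@lebesgue_C R).
Local Notation mu := (@lebesgue_measure R).

Lemma factor_mean_cst (l : nat -> C) N k (o : R) : factor_mean l N k (fun=> 1%E) o = 1%E.
Proof.
rewrite /factor_mean (integral_overlap_factor_pdf N (measurable_cst _))//.
under eq_integral do rewrite mul1e.
by rewrite integral_itv0y_inv_expr -EFinM mulfV// pnatr_eq0.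
Qed.

(** The chain has total mass 1, which identifies the constant of [integral_schur_density] with the
    total mass of the unnormalized conditional law. *)
Lemma overlap_mean_cst (l : nat -> C) N m : overlap_mean l N m (fun=> 1%E) = 1%E.
Proof.
elim: m => //= m IHm; rewrite -[RHS]IHm; congr overlap_mean.
by apply/funext => o; exact: factor_mean_cst.
Qed.

Lemma measurable_left_sqnorm (l : nat -> C) n m : measurable_fun setT
  (fun z : m.-tuple plane => left_sqnorm l n z : measurableTypeR R).
Proof.
have mentry i j : cmeasurable (fun z : m.-tuple plane => entry z i j).
  exact: cmeasurable_nth.
have mcoord i : cmeasurable (fun z : m.-tuple plane => left_coord l z i).
  elim/ltn_ind: i => -[|i] IHi.
    by under [X in cmeasurable X]funext do rewrite left_coord0; exact: cmeasurable_cst.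
  under [X in cmeasurable X]funext do rewrite left_coordS.
  apply: cmeasurableM; last exact: cmeasurable_cst.
  by apply: cmeasurable_sum => j _; apply: cmeasurableM => //; exact: IHi.
rewrite /left_sqnorm; apply: measurable_sum => i.
exact: measurable_sqnormc.
Qed.

Lemma measurable_gram_mx (l : nat -> C) n m p : measurable_fun setT
  (fun z : m.-tuple plane => rdet (gram_mx l n z) ^- p).
Proof.
apply: measurable_inv_expr.
have [] // : cmeasurable (fun z : m.-tuple plane => \det (gram_mx l n z)).
have mT : cmeasurable_mx (fun z : m.-tuple plane => tri_mx l n z).
  move=> i j; under [X in cmeasurable X]funext do rewrite mxE.
  case: (i == j); first exact: cmeasurable_cst.
  case: (i < j)%N; last exact: cmeasurable_cst.
  exact: cmeasurable_nth.
apply: cmeasurable_det; apply: cmeasurable_mxD; first exact: cmeasurable_mx_cst.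
by apply: cmeasurable_mulmx => //; exact: cmeasurable_conjtr.
Qed.

Variables (M : nat) (lam : 'I_M.+1 -> C).
Hypothesis laminj : injective lam.

(* For [k > M], [inord k] is [ord0], whence the bounds in [nat_spectrum_inj]. *)
Definition nat_spectrum k : C := lam (inord k).

Local Notation l := nat_spectrum.

Lemma nat_spectrumE (i : 'I_M.+1) : l i = lam i.
Proof. by rewrite /nat_spectrum inord_val. Qed.

Lemma nat_spectrum_inj i j : (i < M.+1)%N -> (j < M.+1)%N -> l i = l j -> i = j.
Proof.
by move=> iM jM /laminj /(congr1 val)/=; rewrite !inordK.
Qed.

Lemma schur_mxE (z : 'C(M.+1, 2).-tuple plane) : schur_mx lam z = tri_mx l M.+1 z.
Proof. by apply/matrixP => i j; rewrite !mxE nat_spectrumE. Qed.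

Lemma schur_densityE (z : 'C(M.+1, 2).-tuple plane) : schur_density lam z =
  (\prod_(i < M.+1) \prod_(j < M.+1 | (i < j)%N) Normc.normc (lam i - lam j) ^+ 2) *
  rdet (gram_mx l M.+1 z) ^- (M.+1 + M.+1).
Proof. by rewrite /schur_density schur_mxE mul2n -addnn. Qed.

Lemma vandermonde_gt0 :
  0 < \prod_(i < M.+1) \prod_(j < M.+1 | (i < j)%N) Normc.normc (lam i - lam j) ^+ 2.
Proof.
apply: prodr_gt0 => i _; apply: prodr_gt0 => j ij.
rewrite lt_def sqr_ge0 andbT sqrf_eq0; apply/eqP => /Normc.eq0_normc/eqP.
by rewrite subr_eq0 (inj_eq laminj) -(inj_eq val_inj) ltn_eqF.
Qed.

Lemma integral_schur_density : exists2 K : R, 0 < K &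
  forall f, measurable_fun [set: measurableTypeR R] f -> (forall x, 0 <= f x)%E ->
  (\int[tuple_measure lebC 'C(M.+1, 2)]_z
     (f (left_sqnorm l M.+1 z) * (schur_density lam z)%:E) =
  K%:E * overlap_mean l M.+1 M f)%E.
Proof.
have [K K0 KE] := overlap_massE nat_spectrum_inj (ltnSn M).
have V0 := vandermonde_gt0; set V := (\prod_(i < _) _) in V0.
exists (V * K); first exact: mulr_gt0.
move=> f mf f0; rewrite EFinM -muleA -KE// /overlap_mass.
rewrite -ge0_integral_tuple; last 2 first.
- apply: emeasurable_funM; last by apply/measurable_EFinP; exact: measurable_gram_mx.
  by apply: (measurableT_comp mf); exact: measurable_left_sqnorm.
- move=> z; rewrite mule_ge0// lee_fin invr_ge0 exprn_ge0// ltW//.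
  by have [] := posdefmx_rdet (posdefmx_gram_mx l M.+1 z).
rewrite -ge0_integralZl//; last 3 first.
- apply: emeasurable_funM; last by apply/measurable_EFinP; exact: measurable_gram_mx.
  by apply: (measurableT_comp mf); exact: measurable_left_sqnorm.
- move=> z _; rewrite mule_ge0// lee_fin invr_ge0 exprn_ge0// ltW//.
  by have [] := posdefmx_rdet (posdefmx_gram_mx l M.+1 z).
- by rewrite lee_fin ltW.
by apply: eq_integral => z _; rewrite schur_densityE EFinM muleCA.
Qed.

Section random_matrix.
Context d (Om : measurableType d) (Q : probability Om R) (G : Om -> 'M[C]_M.+1).
Hypothesis hG : sph_given_spectrum lam Q G.

(** The overlap is defined by choice, so its sign and measurability are also obtained from the
    pointwise identification [OE] with the squared norm of the left eigenvector. *)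
Lemma sph_overlap_law f : measurable_fun [set: measurableTypeR R] f ->
  (forall x, 0 <= f x)%E ->
  [/\ forall w, 0 <= diag_overlap (G w) lam ord0,
      measurable_fun setT (fun w => diag_overlap (G w) lam ord0 : measurableTypeR R)
    & (\int[Q]_w f (diag_overlap (G w) lam ord0) = overlap_mean l M.+1 M f)%E].
Proof.
move=> mf f0; have [U [Z [uU lawZ GE]]] := hG.
have OE w : diag_overlap (G w) lam ord0 = left_sqnorm l M.+1 (Z w).
  rewrite GE (@diag_overlap_triangular _ _ _ _ _ _ (left_row l M.+1 (Z w)))//.
  - by rewrite left_row_sqnorm.
  - by move=> i j ji; rewrite mxE -(inj_eq val_inj) gtn_eqF// ltnNge ltnW.
  - by move=> i; rewrite mxE eqxx.
  - rewrite schur_mxE left_row_eigen; last exact: nat_spectrum_inj.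
    by rewrite -(nat_spectrumE ord0).
  - by rewrite mxE left_coord0.
have mZ : measurable_fun setT Z by exact: measurable_funP.
have mL : measurable_fun setT
    (fun z : 'C(M.+1, 2).-tuple plane => left_sqnorm l M.+1 z : measurableTypeR R).
  exact: measurable_left_sqnorm.
split.
- by move=> w; rewrite OE; apply: sumr_ge0 => i _; exact: sqnormc_ge0.
- by under eq_fun do rewrite OE; exact: (measurableT_comp mL mZ).
under eq_integral do rewrite OE.
have [K K0 KE] := integral_schur_density.
pose rho z := K^-1 * schur_density lam z.
(* Since the total mass is [K], finite and positive, [mnormalize] divides by it and its default
   measure does not enter. *)
have unnE : schur_cond_unnormalized lam setT = K%:E.
  rewrite /schur_cond_unnormalized.
  have := KE (fun=> 1%E) (measurable_cst _) (fun=> lee01).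
  rewrite overlap_mean_cst mule1 => <-.
  by apply: eq_integral => z _; rewrite mul1e.
have mfL : measurable_fun setT (fun z : 'C(M.+1, 2).-tuple plane => f (left_sqnorm l M.+1 z)).
  exact: (measurableT_comp mf mL).
transitivity (\int[distribution Q Z]_z f (left_sqnorm l M.+1 z))%E.
  by rewrite (ge0_integral_distribution Z mfL).
rewrite (@ge0_integral_density _ _ _ (tuple_measure lebC 'C(M.+1, 2)) _ rho)//; last 3 first.
- by apply: measurable_funM => //; exact: measurable_schur_density.
- by move=> z; rewrite mulr_ge0 ?invr_ge0 ?(ltW K0)// schur_density_ge0.
- move=> B mB; transitivity (schur_cond lam B); first exact: lawZ.
  transitivity (schur_cond_unnormalized lam B * K^-1%:E)%E.
    exact: mnormalizeE.
  rewrite /schur_cond_unnormalized muleC -ge0_integralZl//.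
  + apply: measurable_funTS; apply/measurable_EFinP; exact: measurable_schur_density.
  + by move=> z _; rewrite lee_fin schur_density_ge0.
  + by rewrite lee_fin invr_ge0 ltW.
transitivity (K^-1%:E * (\int[tuple_measure lebC 'C(M.+1, 2)]_z
     (f (left_sqnorm l M.+1 z) * (schur_density lam z)%:E)))%E.
  rewrite -ge0_integralZl//; last 3 first.
  - apply: emeasurable_funM => //; apply/measurable_EFinP; exact: measurable_schur_density.
  - by move=> z _; rewrite mule_ge0// lee_fin schur_density_ge0.
  - by rewrite lee_fin invr_ge0 ltW.
  by apply: eq_integral => z _; rewrite /rho EFinM muleCA.
by rewrite KE// muleA -EFinM mulVf ?gt_eqF// mul1e.
Qed.

End random_matrix.
End conditional_law.

Lemma big_neq_ord0 (T : Type) (idx : T) (op : Monoid.com_law idx) M (F : 'I_M.+1 -> T) :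
  \big[op/idx]_(i < M.+1 | i != ord0) F i = \big[op/idx]_(k < M) F (inord k.+1).
Proof.
rewrite big_mkcond big_ord_recl eqxx Monoid.mul1m; apply: eq_bigr => k _.
by congr F; apply: val_inj; rewrite /= inordK// ltnS.
Qed.

Theorem theorem2p6 (R : realType) (N : nat) (hN : (2 <= N)%N)
    (lam : 'I_N -> R[i]) (hlam : injective lam)
    (i1 : 'I_N) (hi1 : nat_of_ord i1 = 0%N)
    (d : measure_display) (Om : measurableType d) (Q : probability Om R)
    (G : Om -> 'M[R[i]]_N) (hG : sph_given_spectrum lam Q G) :
  let c (k : 'I_N) : R :=
    (1 + Normc.normc (lam i1) ^+ 2) * (1 + Normc.normc (lam k) ^+ 2)
      / Normc.normc (lam i1 - lam k) ^+ 2 in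
  let O11 (w : Om) : R := diag_overlap (G w) lam i1 in
  (forall (d' : measure_display) (Om' : measurableType d')
      (P : probability Om' R) (X : 'I_N -> {RV P >-> R}),
    mutually_independent [set~ i1] X ->
    (forall k, k != i1 -> has_density (X k) (overlap_factor_pdf N)) ->
    forall A : set R, measurable A ->
      Q (O11 @^-1` A) =
      P ((fun w => \prod_(k < N | k != i1) (1 + c k * X k w)) @^-1` A)) /\
  expectation Q O11 = (\prod_(k < N | k != i1) (1 + c k / N%:R))%:E.
Proof.
case: N hN lam hlam i1 hi1 G hG => // M hN lam hlam i1 hi1 G hG c O11.
have i10 : i1 = ord0 by exact: val_inj.
pose l := nat_spectrum lam.
have cE (k : 'I_M) : overlap_coef l k.+1 = c (inord k.+1).
  rewrite /overlap_coef /c !sqnormc_normc i10.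
  by rewrite -[l 0%N]/(l (ord0 : 'I_M.+1)) /l nat_spectrumE.
(* The constant test function serves only to extract nonnegativity and measurability. *)
have [ov_ge0 mO _] := sph_overlap_law hlam hG (measurable_cst 1%E) (fun=> lee01).
split; last first.
  have mnorm : measurable_fun setT (fun x : measurableTypeR R => `|x|%:E : \bar R).
    by apply/measurable_EFinP; exact: normr_measurable.
  have [_ _ meanE] := sph_overlap_law hlam hG mnorm (fun x : R => normr_ge0 x).
  rewrite unlock /O11 i10.
  transitivity (overlap_mean l M.+1 M (fun x => `|x|%:E)).
    by rewrite -meanE; apply: eq_integral => w _; rewrite ger0_norm.
  rewrite overlap_mean_norm// big_neq_ord0; congr EFin; apply: eq_bigr => k _.
  by rewrite cE /c i10.
move=> d' Om' P X indX densX A mA.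
pose X' k : Om' -> measurableTypeR R := X (inord k.+1).
have mX0 k := measurable_funP (X k).
have mX' k : measurable_fun setT (X' k).
  by move=> mT B mB; exact: (mX0 setT (inord k.+1) mT B mB).
have X'E k : (k < M)%N -> inord k.+1 != ord0 :> 'I_M.+1.
  by move=> kM; rewrite -(inj_eq val_inj)/= inordK.
have indX' (B : nat -> set (measurableTypeR R)) : (forall k, measurable (B k)) ->
    P (\big[setI/setT]_(0 <= k < M) (X' k @^-1` B k)) =
    (\prod_(0 <= k < M) P (X' k @^-1` B k))%E.
  (* The factor with index i = k+1 in the spectrum is number k in the sequence; the value of [B'] at
     0 is irrelevant because index 0 is excluded. *)
  move=> mB; pose B' (i : 'I_M.+1) : set R := B i.-1.
  have -> : (\prod_(0 <= k < M) P (X' k @^-1` B k) =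
      \prod_(i in [set~ i1]%SET) P (X i @^-1` B' i))%E.
    rewrite big_mkord i10 [RHS](eq_bigl (fun i => i != ord0)); last by move=> i; rewrite !inE.
    by rewrite big_neq_ord0; apply: eq_bigr => k _; rewrite /B' inordK ?ltnS.
  rewrite -(indX _ B' (subxx _) (fun i => mB _)) i10.
  congr (P _); rewrite big_mkord.
  apply: (eq_trans (esym (bigcap_mkord M (fun k => X' k @^-1` B k)))).
  apply/seteqP; split => w H.
    move=> i /=; rewrite !inE => i0.
    have im : (i.-1 < M)%N by case: i i0 => -[|i] //= iM _.
    have := H i.-1 im; rewrite /X' /B'/= prednK ?lt0n//.
    by rewrite inord_val.
  by move=> k /= kM; have := H (inord k.+1); rewrite /B' /= inordK ?ltnS//; apply; rewrite !inE X'E.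
have densX' k (B : set (measurableTypeR R)) : (k < M)%N -> measurable B ->
    P (X' k @^-1` B) = (\int[@lebesgue_measure R]_(x in B) (overlap_factor_pdf M.+1 x)%:E)%E.
  by move=> kM mB; have := densX (inord k.+1); rewrite i10 => /(_ (X'E k kM))/(_ B mB).
have prodE w : \prod_(k < M.+1 | k != i1) (1 + c k * X k w) = partial_prod l X' M w.
  rewrite i10 big_neq_ord0 /partial_prod; apply: eq_bigr => k _.
  by rewrite cE.
(* Equality in law is tested on indicators, for which both sides equal the same [overlap_mean]. *)
pose f : measurableTypeR R -> \bar R := fun x => (\1_A x)%:E.
have mA' : measurable (A : set (measurableTypeR R)) by exact: mA.
have mf : measurable_fun setT f by apply/measurable_EFinP; exact: measurable_indic.
have f0 x : (0 <= f x)%E by rewrite lee_fin.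
have mprod := measurable_partial_prod l mX' M.
have mpA : measurable (partial_prod l X' M @^-1` A).
  by rewrite -[X in measurable X]setTI; exact: mprod.
have mOA : measurable (O11 @^-1` A).
  by rewrite -[X in measurable X]setTI /O11 i10; exact: mO.
under [in RHS]eq_fun do rewrite prodE.
transitivity (overlap_mean l M.+1 M f).
  have [_ _ <-] := sph_overlap_law hlam hG mf f0; rewrite -i10.
  by rewrite -[X in Q X]setIT -integral_indic.
rewrite -(integral_partial_prod l mX' indX' densX' (leqnn M) mf f0).
by rewrite -[X in _ = P X]setIT -integral_indic.
Qed.
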